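(* Fix $n\in\mathbb{N}$. There exists a càdlàg Markov process $(\mathcal{M}_t)_{t\in[0,\infty)}$ on $\mathcal{S}_n$ which is a regular Mallows process. Moreover, such a process is unique: any two càdlàg Markov processes on $\mathcal{S}_n$ that are regular Mallows processes have the same law.
   Context: $\mathcal{S}_n$ is the set of permutations of $[n]=\{1,\dots,n\}$, written $\sigma=(\sigma(1),\dots,\sigma(n))$. For $\sigma\in\mathcal{S}_n$, $\mathrm{Inv}(\sigma)=|\{i<j:\sigma(i)>\sigma(j)\}|$ and, for $j\in[n]$, $\mathrm{Inv}_j(\sigma)=|\{i\in[j-1]:\sigma(i)>\sigma(j)\}|$, so $\mathrm{Inv}(\sigma)=\sum_j\mathrm{Inv}_j(\sigma)$ and $0\le \mathrm{Inv}_j(\sigma)\le j-1$. For $q\in[0,\infty)$ the Mallows distribution is $\pi_{n,q}(\sigma)=q^{\mathrm{Inv}(\sigma)}/Z_{n,q}$ with $Z_{n,q}=\prod_{k=1}^n\sum_{\ell=0}^{k-1}q^\ell$ (convention $0^0=1$). A Mallows process is an $\mathcal{S}_n$-valued càdlàg process $(\mathcal{M}_t)_{t\ge0}$ with $\mathcal{M}_t\sim\pi_{n,t}$ for every $t\ge0$. It is strongly monotone if for all $t<t'$ and all $j\in[n]$, $\mathrm{Inv}_j(\mathcal{M}_t)\le \mathrm{Inv}_j(\mathcal{M}_{t'})$ (hence also $\mathrm{Inv}(\mathcal{M}_t)\le\mathrm{Inv}(\mathcal{M}_{t'})$); smooth if it is strongly monotone and $\mathrm{Inv}(\mathcal{M}_t)\le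 \mathrm{Inv}(\mathcal{M}_{t-})+1$ for all $t$; it has independent inversions if the processes $(\mathrm{Inv}_j(\mathcal{M}_t))_{t\ge0}$, $j\in[n]$, are mutually independent; it is regular if it is smooth and has independent inversions. *)

(* Defs.v *)
From HB Require Import structures.
From mathcomp Require Import all_boot all_order all_algebra all_fingroup.
From mathcomp Require Import all_classical all_reals all_analysis.
Set Implicit Arguments. Unset Strict Implicit. Unset Printing Implicit Defensive.
Import Order.TTheory GRing.Theory Num.Theory.
Local Open Scope classical_set_scope.
Local Open Scope ring_scope.

Definition inv_j (n : nat) (s : 'S_n) (j : 'I_n) : nat :=
  #|[set i : 'I_n | (i < j)%N && (s j < s i)%N]|.

Definition inv (n : nat) (s : 'S_n) : nat := (\sum_(j < n) inv_j s j)%N.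

Definition mallowsZ (R : realType) (n : nat) (q : R) : R :=
  \prod_(k < n) \sum_(l < k.+1) q ^+ l.

Definition mallows (R : realType) (n : nat) (q : R) (s : 'S_n) : R :=
  q ^+ inv s / mallowsZ n q.

Section Process.
Context (R : realType) (n : nat) (d : measure_display) (T : measurableType d)
  (P : probability T R).

Definition pr (A : set T) : R := fine (P A).

(* A process indexed by time t : R (only t >= 0 is relevant) *)
Definition is_process (M : R -> T -> 'S_n) : Prop :=
  forall t (s : 'S_n), measurable [set w | M t w = s].

Definition cyl (M : R -> T -> 'S_n) (ts : seq (R * 'S_n)) : set T :=
  [set w | all (fun p => M p.1 w == p.2) ts].

Definition nonneg_times (ts : seq (R * 'S_n)) : bool :=
  all (fun p => 0 <= p.1) ts.

End Process.

Definition cadlag (R : realType) (n : nat) (f : R -> 'S_n) : Prop :=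
  (forall t, 0 <= t -> exists2 e : R, 0 < e &
      forall s, t <= s -> s < t + e -> f s = f t) /\
  (forall t, 0 < t -> exists2 e : R, 0 < e & exists sg : 'S_n,
      forall s, t - e < s -> s < t -> f s = sg).

Definition left_limit (R : realType) (n : nat) (f : R -> 'S_n) (t : R) (sg : 'S_n) :=
  exists2 e : R, 0 < e & forall s, t - e < s -> s < t -> f s = sg.

Definition strongly_monotone (R : realType) (n : nat) (f : R -> 'S_n) : Prop :=
  forall t t', 0 <= t -> t < t' -> forall j : 'I_n, (inv_j (f t) j <= inv_j (f t') j)%N.

(* smooth: strongly monotone and Inv(f t) <= Inv(f (t-)) + 1 for all t
   (at t = 0 the convention f(0-) = f(0) makes the condition trivial) *)
Definition smooth (R : realType) (n : nat) (f : R -> 'S_n) : Prop :=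
  strongly_monotone f /\
  forall t, 0 < t -> forall sg, left_limit f t sg -> (inv (f t) <= (inv sg).+1)%N.

Section Props.
Context (R : realType) (n : nat) (d : measure_display) (T : measurableType d)
  (P : probability T R).

(* Markov property w.r.t. the natural filtration (finite-dimensional form):
   P(M_u = x, M_t = s, past) P(M_t = s) = P(M_t = s, past) P(M_u = x, M_t = s)
   for all past times < t < u. *)
Definition markov_property (M : R -> T -> 'S_n) : Prop :=
  forall (ts : seq (R * 'S_n)) (t u : R) (s x : 'S_n),
    all (fun p => (0 <= p.1) && (p.1 < t)) ts -> 0 <= t -> t < u ->
    pr P (cyl M [:: (u, x), (t, s) & ts]) * pr P (cyl M [:: (t, s)]) =
    pr P (cyl M ((t, s) :: ts)) * pr P (cyl M [:: (u, x); (t, s)]).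

Definition cadlag_markov_process (M : R -> T -> 'S_n) : Prop :=
  is_process M /\ {ae P, forall w, cadlag (M^~ w)} /\ markov_property M.

Definition mallows_marginals (M : R -> T -> 'S_n) : Prop :=
  forall t, 0 <= t -> forall s : 'S_n, pr P [set w | M t w = s] = mallows t s.

(* independent inversions: the processes (Inv_j(M_t))_{t>=0}, j in [n], are
   mutually independent (product rule on all finite-dimensional cylinder events) *)
Definition independent_inversions (M : R -> T -> 'S_n) : Prop :=
  forall (ts : seq R) (a : 'I_n -> nat -> nat),
    all (fun t => 0 <= t) ts ->
    pr P [set w | forall (j : 'I_n) (i : nat), (i < size ts)%N ->
                    inv_j (M (nth 0 ts i) w) j = a j i] =
    \prod_(j < n) pr P [set w | forall i : nat, (i < size ts)%N ->
                    inv_j (M (nth 0 ts i) w) j = a j i].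

Definition regular_mallows (M : R -> T -> 'S_n) : Prop :=
  is_process M /\ mallows_marginals M /\
  {ae P, forall w, cadlag (M^~ w)} /\
  {ae P, forall w, smooth (M^~ w)} /\
  independent_inversions M.

End Props.

Definition same_law (R : realType) (n : nat)
  (d1 : measure_display) (T1 : measurableType d1) (P1 : probability T1 R)
  (M1 : R -> T1 -> 'S_n)
  (d2 : measure_display) (T2 : measurableType d2) (P2 : probability T2 R)
  (M2 : R -> T2 -> 'S_n) : Prop :=
  forall ts : seq (R * 'S_n), nonneg_times ts ->
    pr P1 (cyl M1 ts) = pr P2 (cyl M2 ts).

(* Main.v *)
Require Import Defs.
From HB Require Import structures.
From mathcomp Require Import all_boot all_order all_algebra all_fingroup.
From mathcomp Require Import all_classical all_reals all_analysis.
From mathcomp Require Import measurable_realfun.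
From mathcomp Require Import zify ring lra.

(* A permutation is determined by its inversion table [(inv_j s j)_j], which
   ranges over all of [\prod_j {0..j}]; under the Mallows law the entries are
   independent truncated geometric variables.

   Uniqueness.  Cut [[t, u]] into [N] cells.  Up to the probability of a double
   jump in the cell, monotonicity and the marginals determine the joint law of
   one coordinate at the two ends of the cell, hence, by independence, that of
   the process.  By the Markov property the errors add up along the grid, and
   their sum is at most a constant times the probability that some cell contains
   a double jump, which tends to [0] because the paths are cadlag with unit
   jumps.  So the two-time laws agree, and the Markov property gives the
   finite-dimensional ones.

   Existence.  Each coordinate is a pure birth chain, whose jump rate out of
   level [k] is forced by the marginals: with [F k t] the probability of being
   at level [k] or above, [F k.+1' = r k * (F k - F k.+1)].  The chain is built
   one level at a time, on the product of the probability space with [[0, 1]]: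
   the time of arrival at level [k.+1] solves [G xi = v * G tau], where
   [G = exp (- \int r)], [tau] is the time of arrival at level [k] and [v] is
   uniform.  Fubini's theorem reduces the marginals and the Markov property of
   the extended chain to those of the previous one.  Independent copies for all
   the coordinates almost surely never jump together. *)

Set Implicit Arguments. Unset Strict Implicit. Unset Printing Implicit Defensive.
Import Order.TTheory GRing.Theory Num.Theory.
Import numFieldNormedType.Exports.
Local Open Scope classical_set_scope.
Local Open Scope ring_scope.

(** * Inversion tables *)

Lemma inv_jE n (s : 'S_n) (j : 'I_n) :
  inv_j s j = #|[set i : 'I_n | (i < j)%N && (s j < s i)%N]%SET|.
Proof. by apply: eq_card => i; rewrite [RHS]inE; apply/idP/idP; rewrite inE. Qed.

Lemma card_ord_lt n k : (k <= n)%N -> #|[set i : 'I_n | (i < k)%N]%SET| = k.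
Proof.
move=> kn; rewrite -sum1dep_card -(@big_ord_widen _ _ _ k n (fun=> 1%N)) //.
by rewrite sum1_card card_ord.
Qed.

Lemma inv_j_le n (s : 'S_n) (j : 'I_n) : (inv_j s j <= j)%N.
Proof.
rewrite inv_jE -[leqRHS](@card_ord_lt n j) ?(ltnW (ltn_ord j))//.
by apply/subset_leq_card/fintype.subsetP => i; rewrite !inE => /andP[].
Qed.

Lemma inv_j_inj n (s s' : 'S_n) : (forall j, inv_j s j = inv_j s' j) -> s = s'.
Proof.
move=> eqI.
(* At step [m], both permutations order the entries before [m] in the same way,
   so the sets counted by [inv_j] at [m] are upper sets of one common chain:
   they are nested, and equal once they have the same cardinality. *)
have ord_eq m : forall i j : 'I_n, (i < m)%N -> (j < m)%N ->
    (s i < s j)%N = (s' i < s' j)%N.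
  elim: m => // m IH.
  have half (i j : 'I_n) : (i < j)%N -> j = m :> nat ->
      (s j < s i)%N = (s' j < s' i)%N.
    move=> ij jm; have := eqI j; rewrite !inv_jE.
    set A := [set _ | _]%SET; set B := [set _ | _]%SET => cAB.
    suff AB : A = B.
      have : (i \in A) = (i \in B) by rewrite AB.
      by rewrite !inE ij.
    have up (k l : 'I_n) : k \in A -> l \in B -> (k \in B) || (l \in A).
      rewrite !inE => /andP[kj sk] /andP[lj sl]; rewrite kj lj /=.
      have [//|sk' /=] := ltnP (s' j) (s' k).
      have sE := IH k l; rewrite -jm kj lj in sE.
      have := sE isT isT; lia.
    have [AB|/fintype.subsetPn[k kA kB]] := boolP (A \subset B).
      by apply/eqP; rewrite eqEcard AB cAB leqnn.
    apply/esym/eqP; rewrite eqEcard cAB leqnn andbT.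
    by apply/fintype.subsetP => l lB; have := up k l kA lB; rewrite (negbTE kB).
  have neq (f : 'S_n) (i j : 'I_n) : i != j -> f i != f j :> nat.
    by rewrite val_eqE (inj_eq perm_inj).
  move=> i j; rewrite !ltnS leq_eqVlt => /predU1P[im|im]; rewrite leq_eqVlt.
    move=> /predU1P[jm|jm].
      by rewrite (_ : i = j) ?ltnn//; apply: val_inj; rewrite /= im.
    by rewrite (half j i) ?im.
  move=> /predU1P[jm|jm]; last exact: IH.
  have ij : i != j by rewrite -val_eqE /=; lia.
  have := half i j _ jm; rewrite {1}jm im => /(_ isT).
  have := neq s i j ij; have := neq s' i j ij; lia.
(* A value is its own rank: [f i] counts the entries below it, so the order of the entries
   determines the permutation. *)
have rank (f : 'S_n) i : f i = #|[set k | (f k < f i)%N]%SET| :> nat.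
  rewrite -[LHS](@card_ord_lt n) ?(ltnW (ltn_ord _))//.
  rewrite -[LHS](card_imset _ (@perm_inj _ f^-1)); apply: eq_card => k.
  apply/imsetP/idP => [[l]|].
    by rewrite !inE => lt ->; rewrite permKV.
  rewrite inE => lt.
  by exists (f k); rewrite ?permK ?inE.
apply/permP => i; apply: val_inj; rewrite /= (rank s) (rank s').
by apply: eq_card => k; rewrite !inE; apply: (ord_eq n).
Qed.

(** By counting: [code] is injective on the [n!] permutations, and there are exactly [n!] admissible
    tables. *)
Lemma inv_j_surj n (c : 'I_n -> nat) : (forall j, (c j <= j)%N) ->
  exists s : 'S_n, forall j, inv_j s j = c j.
Proof.
move=> cj.
pose code (s : 'S_n) : {ffun 'I_n -> 'I_n} :=
  [ffun j => Ordinal (leq_ltn_trans (inv_j_le s j) (ltn_ord j))].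
have code_inj : injective code.
  move=> s s' ss'; apply: inv_j_inj => j.
  by have := congr1 (fun f : {ffun 'I_n -> 'I_n} => val (f j)) ss'; rewrite !ffunE.
pose F (j : 'I_n) := [pred i : 'I_n | (i < j.+1)%N].
have code_fam s : code s \in family F.
  by apply/familyP => j; rewrite ffunE inE /= ltnS inv_j_le.
have cardF : #|family F| = n`!.
  rewrite card_family fact_prod big_add1 /= big_mkord.
  rewrite foldrE big_map big_enum /=; apply: eq_bigr => j _.
  by rewrite -[RHS](@card_ord_lt n) //; apply: eq_card => i; rewrite !inE.
have im_code : [set code s | s in [set: 'S_n]]%SET = [set f in family F]%SET.
  apply/eqP; rewrite eqEcard card_imset // cardsT card_Sn cardsE cardF leqnn.
  by rewrite andbT; apply/fintype.subsetP => _ /imsetP[s _ ->]; rewrite inE.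
pose f := [ffun j : 'I_n => Ordinal (leq_ltn_trans (cj j) (ltn_ord j))].
have : f \in [set code s | s in [set: 'S_n]]%SET.
  by rewrite im_code inE; apply/familyP => j; rewrite ffunE inE /= ltnS.
move=> /imsetP[s _ fs]; exists s => j.
by have := congr1 (fun g : {ffun 'I_n -> 'I_n} => val (g j)) fs; rewrite !ffunE.
Qed.

(** * Finite-valued random variables *)

Section FiniteValued.
Context (R : realType) (d : measure_display) (T : measurableType d)
  (P : probability T R).
Implicit Types (A B : set T).

Definition fin_measurable (F : finType) (f : T -> F) :=
  forall x, measurable [set w | f w = x].

Lemma fin_measurable_pred (F : finType) (f : T -> F) (Q : pred F) :
  fin_measurable f -> measurable [set w | Q (f w)].
Proof.
move=> mf.
rewrite (_ : [set w | Q (f w)] = \bigcup_(x in [set` Q]) [set w | f w = x]).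
  by apply: fin_bigcup_measurable => //; exact: finite_finpred.
apply/seteqP; split => [w Qw|w [x /= Qx ->]//]; first by exists (f w).
Qed.

Lemma fin_measurable_pair (F F' : finType) (f : T -> F) (g : T -> F') :
  fin_measurable f -> fin_measurable g ->
  fin_measurable (fun w => (f w, g w)).
Proof.
move=> mf mg [x y].
rewrite (_ : [set _ | _] = [set w | f w = x] `&` [set w | g w = y]).
  exact: measurableI.
by apply/seteqP; split => [w [/= -> ->]//|w [<- <-]].
Qed.

Lemma fin_measurable_comp (F F' : finType) (h : F -> F') (f : T -> F) :
  fin_measurable f -> fin_measurable (h \o f).
Proof.
move=> mf y; rewrite (_ : [set _ | _] = [set w | (h (f w) == y)]).
  exact: (@fin_measurable_pred _ f (fun x => h x == y)).
by apply/seteqP; split => w /= /eqP.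
Qed.

Lemma pr_ge0 A : 0 <= pr P A.
Proof. exact: fine_ge0. Qed.

Lemma pr0 : pr P set0 = 0.
Proof. by rewrite /pr measure0. Qed.

Lemma prT : pr P setT = 1.
Proof. by rewrite /pr probability_setT. Qed.

Lemma prK A : measurable A -> (pr P A)%:E = P A.
Proof. by move=> mA; rewrite /pr fineK// fin_num_measure. Qed.

Lemma le_pr A B : measurable A -> measurable B -> A `<=` B -> pr P A <= pr P B.
Proof. by move=> mA mB AB; rewrite -lee_fin !prK// le_measure// inE. Qed.

Lemma prU A B : measurable A -> measurable B -> A `&` B = set0 ->
  pr P (A `|` B) = pr P A + pr P B.
Proof.
move=> mA mB AB; apply: EFin_inj; rewrite EFinD !prK//; last exact: measurableU.
by rewrite measureU.
Qed.

Lemma pr_ae_eq0 A (Q : T -> Prop) : measurable A -> {ae P, forall w, Q w} ->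
  (forall w, A w -> ~ Q w) -> pr P A = 0.
Proof.
move=> mA [N [mN N0 QN]] AQ; apply/eqP; rewrite eq_le pr_ge0 andbT.
rewrite -lee_fin prK// -[leRHS]N0 le_measure ?inE// => w Aw.
by apply: QN; exact: AQ.
Qed.

Lemma pr_fibers (F : finType) (f : T -> F) A : fin_measurable f -> measurable A ->
  pr P A = \sum_(x : F) pr P (A `&` [set w | f w = x]).
Proof.
move=> mf mA.
have aux (s : seq F) : uniq s -> pr P (A `&` [set w | f w \in s]) =
    \sum_(x <- s) pr P (A `&` [set w | f w = x]).
  elim: s => [_|x s IH /= /andP[xs us]].
    by rewrite big_nil -[RHS]pr0; congr pr; apply/seteqP; split => // w [].
  rewrite big_cons -IH// -prU; last 1 first.
  - apply/seteqP; split => // w [[_ /= ->] [_ /=]]; by rewrite (negbTE xs).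
  - congr pr; rewrite -setIUr; congr setI; apply/seteqP; split => w /=.
      by rewrite inE => /predU1P.
    by rewrite inE => /predU1P.
  - exact: measurableI.
  - by apply: measurableI => //; exact: (@fin_measurable_pred _ f (mem s)).
rewrite -big_enum -aux ?enum_uniq//; congr pr.
by apply/seteqP; split => w /= => [Aw|[]//]; split; rewrite // mem_enum.
Qed.

(** The expectation of [g \o f] restricted to [A]. As a finite sum it raises no integrability
    question. *)
Definition fexp A (F : finType) (f : T -> F) (g : F -> R) : R :=
  \sum_(x : F) pr P (A `&` [set w | f w = x]) * g x.

Lemma fexp_comp A (F F' : finType) (f : T -> F) (h : F -> F') (g : F' -> R) :
  fin_measurable f -> measurable A -> fexp A f (g \o h) = fexp A (h \o f) g.
Proof.
move=> mf mA; rewrite /fexp.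
under [RHS]eq_bigr => y _.
  rewrite (pr_fibers mf) ?mulr_suml; last first.
    by apply: measurableI => //; exact: fin_measurable_comp.
  over.
rewrite exchange_big /=; apply: eq_bigr => x _.
rewrite (bigD1 (h x)) //= [X in _ + X]big1 ?addr0.
  congr (pr P _ * _); apply/seteqP; split => w /=; first by move=> [Aw ->].
  by move=> [[Aw _] ->].
move=> y yhx; rewrite (_ : _ `&` _ = set0) ?pr0 ?mul0r//.
by apply/seteqP; split => // w [[_ /= hfw] fw]; rewrite -hfw fw eqxx in yhx.
Qed.

Lemma pr_fexp A (F : finType) (f : T -> F) (Q : pred F) :
  fin_measurable f -> measurable A ->
  pr P (A `&` [set w | Q (f w)]) = fexp A f (fun x => (Q x)%:R).
Proof.
move=> mf mA; rewrite (pr_fibers mf); last first.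
  by apply: measurableI => //; exact: fin_measurable_pred.
apply: eq_bigr => x _; case: (boolP (Q x)) => Qx; rewrite ?mulr1 ?mulr0.
  by congr pr; apply/seteqP; split => w /= => [[[]]|[Aw fx]]; rewrite ?fx.
rewrite (_ : _ `&` _ = set0) ?pr0//; apply/seteqP; split => // w [[_ /=] + fx].
by rewrite fx (negbTE Qx).
Qed.

Lemma fexpD A (F : finType) (f : T -> F) g h :
  fexp A f (fun x => g x + h x) = fexp A f g + fexp A f h.
Proof. by rewrite -big_split; apply: eq_bigr => x _; rewrite mulrDr. Qed.

Lemma fexpB A (F : finType) (f : T -> F) g h :
  fexp A f (fun x => g x - h x) = fexp A f g - fexp A f h.
Proof. by rewrite -sumrB; apply: eq_bigr => x _; rewrite mulrBr. Qed.

(** Values of probability [0] are exempt from the comparison, which lets almost sure properties of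
    the paths be used. *)
Lemma le_fexp A (F : finType) (f : T -> F) g h :
  (forall x, pr P (A `&` [set w | f w = x]) = 0 \/ g x <= h x) ->
  fexp A f g <= fexp A f h.
Proof.
move=> gh; apply: ler_sum => x _; have [->|] := gh x; first by rewrite !mul0r.
by apply: ler_wpM2l; exact: pr_ge0.
Qed.

Lemma ler_norm_fexp A (F : finType) (f : T -> F) g :
  `|fexp A f g| <= fexp A f (fun x => `|g x|).
Proof.
apply: le_trans (ler_norm_sum _ _ _) _; apply: ler_sum => x _.
by rewrite normrM ger0_norm ?pr_ge0.
Qed.

End FiniteValued.

(** * Uniqueness *)

Section TwoTimes.
Context (R : realType) (n : nat) (d : measure_display) (T : measurableType d)
  (P : probability T R) (M : R -> T -> 'S_n).
Hypothesis mM : is_process M.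

Definition joint (t u : R) (s x : 'S_n) : R :=
  pr P [set w | (M t w, M u w) = (s, x)].

Definition jump2 (t u : R) : R :=
  pr P [set w | ((Defs.inv (M t w)).+2 <= Defs.inv (M u w))%N].

Let mMM t u : fin_measurable (fun w => (M t w, M u w)).
Proof. by apply: fin_measurable_pair => z; exact: mM. Qed.

Lemma joint_ge0 t u s x : 0 <= joint t u s x.
Proof. exact: pr_ge0. Qed.

Lemma joint_cyl t u s x : joint t u s x = pr P (cyl M [:: (u, x); (t, s)]).
Proof.
congr pr; rewrite /cyl; apply/seteqP; split => w /=.
  by move=> [-> ->]; rewrite !eqxx.
by move=> /andP[/eqP -> /andP[/eqP -> _]].
Qed.

Lemma sum_jointr t u s : \sum_x joint t u s x = pr P [set w | M t w = s].
Proof.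
rewrite [RHS](pr_fibers P (mM u) (mM t s)); apply: eq_bigr => x _.
congr pr; apply/seteqP; split => w /=; first by move=> [-> ->].
by move=> [-> ->].
Qed.

Lemma sum_jointl t u x : \sum_s joint t u s x = pr P [set w | M u w = x].
Proof.
rewrite [RHS](pr_fibers P (mM t) (mM u x)); apply: eq_bigr => s _.
congr pr; apply/seteqP; split => w /=; first by move=> [-> ->].
by move=> [-> ->].
Qed.

Lemma joint_lel t u s x : joint t u s x <= pr P [set w | M t w = s].
Proof.
apply: le_pr => //; first exact: mMM.
by move=> w /= [->].
Qed.

Lemma joint_refl t s x :
  joint t t s x = (s == x)%:R * pr P [set w | M t w = s].
Proof.
have [<-|sx] := eqVneq s x; rewrite ?mul1r ?mul0r.
  congr pr; apply/seteqP; split => w /=; first by case.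
  by move=> ->.
rewrite -[RHS](@pr0 _ _ _ P); congr pr; apply/seteqP; split => // w /= [-> sx'].
by rewrite sx' eqxx in sx.
Qed.

Hypothesis smoothM : {ae P, forall w, smooth (M^~ w)}.

(** Monotonicity holds almost surely, so a pair violating it carries no mass. The disjunction has
    the form that [le_fexp] expects. *)
Lemma pr_nonmono A t u s x : 0 <= t -> t < u -> measurable A ->
  pr P (A `&` [set w | (M t w, M u w) = (s, x)]) = 0 \/
  forall j, (inv_j s j <= inv_j x j)%N.
Proof.
move=> t0 tu mA.
have [|nle] := pselect (forall j, (inv_j s j <= inv_j x j)%N); first by right.
left; apply: pr_ae_eq0 smoothM _.
  by apply: measurableI => //; exact: mMM.
by move=> w [_ /= E] [mono _]; apply: nle => j; case: E => <- <-; exact: mono.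
Qed.

Lemma inv_increment (s x : 'S_n) j : (forall i, (inv_j s i <= inv_j x i)%N) ->
  (inv_j x j - inv_j s j <= Defs.inv x - Defs.inv s)%N.
Proof.
move=> le; rewrite /Defs.inv (bigD1 j)//= [in X in (_ <= _ - X)%N](bigD1 j)//=.
have /= := @leq_sum _ (index_enum 'I_n) (fun i => i != j) (inv_j s) (inv_j x)
  (fun i _ => le i).
move: (le j); move: (\sum_(i | _) inv_j s i)%N (\sum_(i | _) inv_j x i)%N.
move=> a b.
by lia.
Qed.

(* Up to the event of a double jump, the two-time law of one coordinate
   is the combination [drift1 (M t) + drift2 (M u)] of its marginals. *)
Definition drift1 (j : 'I_n) (a b : nat) (s : 'S_n) : R :=
  if b == a then (inv_j s j == a)%:R - (inv_j s j <= a)%N%:R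
  else if b == a.+1 then (inv_j s j <= a)%N%:R else 0.

Definition drift2 (j : 'I_n) (a b : nat) (x : 'S_n) : R :=
  if b == a then (inv_j x j <= a)%N%:R
  else if b == a.+1 then - (inv_j x j <= a)%N%:R else 0.

(** Write [X <= Y] for the values of coordinate [j] in [s] and [x]. If [Y <= X + 1], the indicator
    of [X = Y = a] is that of [Y <= a] minus that of [X < a], and the indicator of
    [X = a, Y = a + 1] is that of [X <= a] minus that of [Y <= a]: each term involves one time only.
    In the remaining cases the error is at most [1]. *)
Lemma drift_close j a b (s x : 'S_n) : (forall i, (inv_j s i <= inv_j x i)%N) ->
  `|((inv_j s j == a) && (inv_j x j == b))%:R
     - (drift1 j a b s + drift2 j a b x)|
  <= ((Defs.inv s).+2 <= Defs.inv x)%N%:R.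
Proof.
move=> le; have := inv_increment j le; have := le j.
rewrite /drift1 /drift2.
move: (inv_j s j) (inv_j x j) (Defs.inv s) (Defs.inv x) => X Y I I' XY YX.
have [bad|good] := boolP (I.+2 <= I')%N.
  case: (eqVneq b a) => [->|_].
    case: (ltngtP X a) => Xa; case: (ltngtP Y a) => Ya /=; try lia;
    rewrite ler_norml; apply/andP; split; lra.
  case: (eqVneq b a.+1) => [->|_].
    case: (ltngtP X a) => Xa; case: (ltngtP Y a) => Ya /=; try lia;
    case: (eqVneq Y a.+1) => Ya1 /=;
    rewrite ler_norml; apply/andP; split; lra.
  by case: (_ && _) => /=; rewrite ler_norml; apply/andP; split; lra.
move: good; rewrite -ltnNge => good.
have {}YX : (Y <= X.+1)%N by lia.
rewrite normr_le0 subr_eq0; apply/eqP.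
case: (eqVneq b a) => [->|ba].
  case: (ltngtP X a) => Xa; case: (ltngtP Y a) => Ya /=; try lia; lra.
case: (eqVneq b a.+1) => [->|ba1].
  case: (ltngtP X a) => Xa; case: (ltngtP Y a) => Ya /=; try lia;
  case: (eqVneq Y a.+1) => Ya1 /=; try lia; lra.
case: (eqVneq X a) => [Xa|]; case: (eqVneq Y b) => [Yb|] /=; rewrite ?addr0//.
by lia.
Qed.

(** The expectation of [drift_close]. The two [fexp] terms depend only on the one-time marginals,
    hence agree for all Mallows processes. *)
Lemma coord_close j a b t u : 0 <= t -> t < u ->
  `|pr P [set w | inv_j (M t w) j = a /\ inv_j (M u w) j = b]
    - (fexp P setT (M t) (drift1 j a b) + fexp P setT (M u) (drift2 j a b))|
  <= jump2 t u.
Proof.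
move=> t0 tu.
pose f w := (M t w, M u w).
pose Q (p : 'S_n * 'S_n) := (inv_j p.1 j == a) && (inv_j p.2 j == b).
pose B (p : 'S_n * 'S_n) := ((Defs.inv p.1).+2 <= Defs.inv p.2)%N.
have -> : [set w | inv_j (M t w) j = a /\ inv_j (M u w) j = b] =
    setT `&` [set w | Q (f w)].
  rewrite setTI; apply/seteqP; split => w /=; rewrite /Q /=.
    by move=> [-> ->]; rewrite !eqxx.
  by move=> /andP[/eqP-> /eqP->].
have -> : jump2 t u = fexp P setT f (fun p => (B p)%:R).
  by rewrite -(pr_fexp P B (mMM t u) measurableT) setTI.
rewrite (pr_fexp P Q (mMM t u) measurableT).
have -> : fexp P setT (M t) (drift1 j a b) =
    fexp P setT f (fun p => drift1 j a b p.1).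
  exact/esym/(@fexp_comp _ _ _ P setT _ _ f fst (drift1 j a b) (mMM t u)).
have -> : fexp P setT (M u) (drift2 j a b) =
    fexp P setT f (fun p => drift2 j a b p.2).
  exact/esym/(@fexp_comp _ _ _ P setT _ _ f snd (drift2 j a b) (mMM t u)).
rewrite -fexpD -fexpB; apply: le_trans (ler_norm_fexp _ _ _ _) _.
apply: le_fexp => -[s x].
have [->|mono] := @pr_nonmono setT t u s x t0 tu measurableT; first by left.
by right; exact: drift_close.
Qed.

Lemma inv_le (s : 'S_n) : (Defs.inv s <= n * n)%N.
Proof.
rewrite /Defs.inv; apply: (@leq_trans (\sum_(j < n) n)%N).
  by apply: leq_sum => j _; rewrite (leq_trans (inv_j_le _ _))// ltnW.
by rewrite sum_nat_const card_ord.
Qed.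

Lemma inv_mono (s x : 'S_n) : (forall i, (inv_j s i <= inv_j x i)%N) ->
  (Defs.inv s <= Defs.inv x)%N.
Proof. by move=> le; apply: leq_sum. Qed.

Lemma measurable_jump2 t u :
  measurable [set w | ((Defs.inv (M t w)).+2 <= Defs.inv (M u w))%N].
Proof.
exact: (fin_measurable_pred
  (fun p : 'S_n * 'S_n => ((Defs.inv p.1).+2 <= Defs.inv p.2)%N) (mMM t u)).
Qed.

(* Along a path, the number of cells carrying a double jump is at most the
   total increase of [inv], and it vanishes off [A]. *)
Lemma sum_jump2_le (tau : nat -> R) N A : measurable A ->
  (forall i, (i < N)%N -> 0 <= tau i /\ tau i < tau i.+1) ->
  (forall i, (i < N)%N ->
    [set w | ((Defs.inv (M (tau i) w)).+2 <= Defs.inv (M (tau i.+1) w))%N] `<=` A) ->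
  \sum_(0 <= i < N) jump2 (tau i) (tau i.+1) <= (n * n)%:R * pr P A.
Proof.
move=> mA tauP jA.
pose g (s : 'S_n) : R := (Defs.inv s)%:R.
have step i : (i < N)%N -> jump2 (tau i) (tau i.+1) <=
    fexp P A (M (tau i.+1)) g - fexp P A (M (tau i)) g.
  move=> iN; have [ti0 ti] := tauP i iN.
  pose f w := (M (tau i) w, M (tau i.+1) w).
  pose B (p : 'S_n * 'S_n) := ((Defs.inv p.1).+2 <= Defs.inv p.2)%N.
  have -> : jump2 (tau i) (tau i.+1) = fexp P A f (fun p => (B p)%:R).
    rewrite -(pr_fexp P B (mMM _ _) mA).
    by congr pr; apply/seteqP; split => w //= Bw; [split=> //; exact: (jA i)|case: Bw].
  rewrite -(@fexp_comp _ _ _ P A _ _ f fst g (mMM _ _))//.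
  rewrite -(@fexp_comp _ _ _ P A _ _ f snd g (mMM _ _))//.
  rewrite -fexpB; apply: le_fexp => -[s x].
  have [->|mono] := @pr_nonmono A _ _ s x ti0 ti mA; first by left.
  right; rewrite /B /g /= -natrB ?inv_mono// ler_nat.
  by case: leqP => //=; lia.
apply: (@le_trans _ _ (\sum_(0 <= i < N)
    (fexp P A (M (tau i.+1)) g - fexp P A (M (tau i)) g))).
  by rewrite !big_nat; apply: ler_sum => i /andP[_ iN]; exact: step.
rewrite (telescope_sumr (fun i => fexp P A (M (tau i)) g))//.
have g0 : 0 <= fexp P A (M (tau 0)) g.
  by apply: sumr_ge0 => s _; rewrite mulr_ge0 ?pr_ge0.
apply: (@le_trans _ _ (fexp P A (M (tau N)) g)); first by lra.
rewrite [in leRHS](pr_fibers P (mM (tau N)) mA) mulr_sumr.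
apply: ler_sum => s _; rewrite mulrC ler_wpM2r ?pr_ge0//.
by rewrite /g ler_nat inv_le.
Qed.

End TwoTimes.

(** The factors are exchanged one at a time, the others being bounded by [1]. *)
Lemma ler_dist_prod (R : realType) (I : Type) (r : seq I) (a b : I -> R) :
  (forall i, 0 <= a i <= 1) -> (forall i, 0 <= b i <= 1) ->
  `|\prod_(i <- r) a i - \prod_(i <- r) b i| <= \sum_(i <- r) `|a i - b i|.
Proof.
move=> a01 b01; elim: r => [|i r IH]; first by rewrite !big_nil subrr normr0.
rewrite !big_cons.
set A := \prod_(j <- r) a j in IH *; set B := \prod_(j <- r) b j in IH *.
have B0 : 0 <= B by apply: prodr_ge0 => j _; case/andP: (b01 j).
have B1 : B <= 1 by apply: Num.Theory.prodr_ile1 => j _; exact: b01.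
rewrite (_ : a i * A - b i * B = a i * (A - B) + (a i - b i) * B); last by ring.
apply: le_trans (ler_normD _ _) _; rewrite !normrM addrC.
have /andP[ai0 ai1] := a01 i.
apply: lerD; first by rewrite (ger0_norm B0) ler_piMr.
by apply: le_trans IH; rewrite (ger0_norm ai0) ler_piMl.
Qed.

(** Around each time the path takes only its left limit and its current value, and these differ by
    at most one inversion; compactness of [[t, u]] makes the size of the neighbourhood uniform. *)
Lemma eventually_no_jump2 (R : realType) n (f : R -> 'S_n) (t u : R) :
  0 <= t -> cadlag f -> smooth f ->
  exists2 delta : R, 0 < delta & forall x y, t <= x -> x <= u -> x <= y ->
    y < x + delta -> (Defs.inv (f y) <= (Defs.inv (f x)).+1)%N.
Proof.
move=> t0 [rc ll] [mono sm].
pose Q (delta x : R) := 0 <= x -> forall y, x <= y -> y < x + delta ->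
  (Defs.inv (f y) <= (Defs.inv (f x)).+1)%N.
have cov : \forall delta \near 0^'+, `[t, u] `<=` Q delta.
  have /compact_near_coveringP := @segment_compact R t u; apply.
  move=> x /=; rewrite in_itv/= => /andP[tx xu].
  have x0 : 0 <= x := le_trans t0 tx.
  have [e1 e10 fr] := rc x x0.
  (* At [x = 0] there is no left limit, but [Q] constrains nonnegative times only, so right
     continuity suffices. *)
  have [x_gt0|x_le0] := ltP 0 x; last first.
    have {x0 x_le0}x0 : x = 0 by apply/eqP; rewrite eq_le x0 x_le0.
    exists (ball x (e1 / 2), [set delta | delta < e1 / 2]).
      split => /=; first by apply: nbhsx_ballx; rewrite divr_gt0.
      by apply: nbhs_right_lt; rewrite divr_gt0.
    move=> [z delta] [/= xz de] z0 y zy yz.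
    rewrite /ball/= ltr_norml in xz; case/andP: xz => xz zx.
    by rewrite !fr//; lra.
  have [e2 e20 [sg fl]] := ll x x_gt0.
  have sgx : (Defs.inv (f x) <= (Defs.inv sg).+1)%N.
    by apply: sm => //; exists e2.
  pose e := Num.min e1 e2.
  have e0 : 0 < e by rewrite lt_min e10.
  have [ee1 ee2] : e <= e1 /\ e <= e2 by rewrite !ge_min !lexx orbT.
  exists (ball x (e / 2), [set delta | delta < e / 2]).
    split => /=; first by apply: nbhsx_ballx; rewrite divr_gt0.
    by apply: nbhs_right_lt; rewrite divr_gt0.
  move=> [z delta] [/= xz de] z0 y zy yz.
  rewrite /ball/= ltr_norml in xz; case/andP: xz => xz zx.
  have [xlez|zltx] := leP x z; first by rewrite !fr//; lra.
  rewrite (fl z)//; last by lra.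
  have [xley|yltx] := leP x y; first by rewrite fr//; lra.
  by rewrite fl//; lra.
have [delta [d0 Qd]] := filter_ex (filterI (nbhs_right_gt (0 : R)) cov).
exists delta => // x y tx xu xy yx; apply: Qd => //=.
  by rewrite in_itv/= tx.
exact: le_trans tx.
Qed.

(** * Double jumps in the cells of a refining grid *)

Section Grid.
Context (R : realType) (t u : R).

(** There are [N.+1] cells, so the denominator never vanishes. *)
Definition grid (N i : nat) : R := t + (u - t) * (i%:R / N.+1%:R).

Lemma grid0 N : grid N 0 = t.
Proof. by rewrite /grid mul0r mulr0 addr0. Qed.

Lemma gridN N : grid N N.+1 = u.
Proof. by rewrite /grid divff ?mulr1 ?pnatr_eq0// addrC subrK. Qed.

Lemma gridS N i : grid N i.+1 = grid N i + (u - t) / N.+1%:R.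
Proof. by rewrite /grid -[i.+1%:R]natr1; ring. Qed.

Hypothesis tu : t < u.

Lemma grid_lt N i k : (i < k)%N -> grid N i < grid N k.
Proof.
move=> ik; rewrite /grid ltrD2l ltr_pM2l ?subr_gt0//.
by rewrite ltr_pM2r ?invr_gt0 ?ltr0n// ltr_nat.
Qed.

Lemma grid_ge N i : t <= grid N i.
Proof. by rewrite /grid lerDl mulr_ge0 ?divr_ge0 ?subr_ge0// ltW. Qed.

Lemma grid_le N i : (i <= N.+1)%N -> grid N i <= u.
Proof.
rewrite leq_eqVlt => /predU1P[->|iN]; first by rewrite gridN.
by rewrite -[leRHS](gridN N) ltW// grid_lt.
Qed.

End Grid.

Section Limit.
Context (R : realType) (n : nat) (d : measure_display) (T : measurableType d)
  (P : probability T R) (M : R -> T -> 'S_n).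
Hypothesis mM : is_process M.
Hypothesis cadlagM : {ae P, forall w, cadlag (M^~ w)}.
Hypothesis smoothM : {ae P, forall w, smooth (M^~ w)}.
Context (t u : R).
Hypotheses (t0 : 0 <= t) (tu : t < u).

Definition grid_jump2 (N : nat) : set T :=
  \bigcup_(i in [set k | (k < N.+1)%N]) [set w |
    ((Defs.inv (M (grid t u N i) w)).+2 <= Defs.inv (M (grid t u N i.+1) w))%N].

Lemma measurable_grid_jump2 N : measurable (grid_jump2 N).
Proof. by apply: bigcup_measurable => i _; exact: measurable_jump2. Qed.

(** By [eventually_no_jump2], almost every path lies in finitely many of the events [grid_jump2 N].
    Their limit superior is therefore null, and continuity from above bounds the tail unions, which
    contain the events themselves. *)
Lemma grid_jump2_cvg0 (e : R) : 0 < e ->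
  exists N0, forall N, (N0 <= N)%N -> pr P (grid_jump2 N) < e.
Proof.
move=> e0.
have limsup0 : P (lim_sup_set grid_jump2) = 0%E.
  have [N [mN N0 sub]] : P.-negligible (lim_sup_set grid_jump2).
    have [N [mN N0 sub]] : {ae P, forall w, cadlag (M^~ w) /\ smooth (M^~ w)}.
      exact: filterI.
    exists N; split => // w wl; apply: sub => /= -[cad sm].
    have [dl d0 nojump] := @eventually_no_jump2 R n (M^~ w) t u t0 cad sm.
    have [k kd] : exists k : nat, (u - t) / k.+1%:R < dl.
      have ut0 : 0 < u - t by rewrite subr_gt0.
      exists (Num.trunc ((u - t) / dl)).
      rewrite ltr_pdivrMr ?ltr0n// mulrC -ltr_pdivrMr//.
      exact: truncnS_gt.
    have [m /= km [i /= im]] := wl k I.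
    rewrite ltnNge => /negP; apply.
    apply: nojump.
    - exact: grid_ge.
    - by apply: grid_le => //; exact: ltnW.
    - by apply/ltW/grid_lt.
    - rewrite gridS ltrD2l; apply: le_lt_trans kd.
      by rewrite ler_pM2l ?subr_gt0// lef_pV2 ?posrE ?ltr0n// ler_nat.
  apply/eqP; rewrite eq_le measure_ge0 andbT -N0 le_measure ?inE//.
  apply: bigcapT_measurable => k; apply: bigcup_measurable => i _.
  exact: measurable_grid_jump2.
have mU k : measurable (\bigcup_(i in [set i | (k <= i)%N]) grid_jump2 i).
  by apply: bigcup_measurable => i _; exact: measurable_grid_jump2.
have PU k : (P (\bigcup_(i in [set i | (k <= i)%N]) grid_jump2 i) < +oo)%E.
  by rewrite (le_lt_trans (probability_le1 _ _))// ltry.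
have : P (\bigcup_(i in [set i | (k <= i)%N]) grid_jump2 i) @[k --> \oo] --> 0%E.
  rewrite -limsup0; apply: lim_sup_set_cvg; first exact: measurable_grid_jump2.
  exact: PU.
move=> /fine_cvgP[_ /cvgrPdist_lt/(_ e e0)].
move=> [N0 _ cl]; exists N0 => N NN.
have := cl N0 (leqnn N0); rewrite /= sub0r normrN => lt_e.
apply: le_lt_trans lt_e; rewrite ger0_norm ?fine_ge0//.
apply: (@le_pr _ _ _ P); [exact: measurable_grid_jump2|exact: mU|].
by move=> w jw; exists N.
Qed.

Lemma sum_grid_jump2 N :
  \sum_(0 <= i < N.+1) jump2 P M (grid t u N i) (grid t u N i.+1) <=
  (n * n)%:R * pr P (grid_jump2 N).
Proof.
apply: sum_jump2_le => //; first exact: measurable_grid_jump2.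
  move=> i _; split; first by rewrite (le_trans t0)// grid_ge.
  exact: grid_lt.
by move=> i iN w jw; exists i.
Qed.

End Limit.

(** * Consequences of the Markov property and of independence for two-time laws *)

Section Markov.
Context (R : realType) (n : nat) (d : measure_display) (T : measurableType d)
  (P : probability T R) (M : R -> T -> 'S_n).
Hypothesis mM : is_process M.

Lemma cyl_nil : cyl M [::] = setT.
Proof. by apply/seteqP. Qed.

Lemma measurable_cyl ts : measurable (cyl M ts).
Proof.
elim: ts => [|p ts IH]; first by rewrite cyl_nil.
rewrite (_ : cyl M _ = [set w | M p.1 w = p.2] `&` cyl M ts).
  exact: measurableI.
rewrite /cyl; apply/seteqP; split => w /=; first by move=> /andP[/eqP].
by move=> [-> ->]; rewrite eqxx.
Qed.

Hypothesis markovM : markov_property P M.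

(** The Chapman-Kolmogorov equation. The quotient is the transition probability; it is [0], by the
    convention on division, where [M t] has no mass. The case [t0 = t] is included because the grid
    begins at its initial time. *)
Lemma joint_step (t0 t u : R) (a x : 'S_n) : 0 <= t0 -> t0 <= t -> t < u ->
  joint P M t0 u a x =
  \sum_s joint P M t0 t a s * (joint P M t u s x / pr P [set w | M t w = s]).
Proof.
move=> t00 t0t tu.
have null s y : pr P [set w | M t w = s] = 0 -> joint P M t u s y = 0.
  move=> m0; apply/eqP; rewrite eq_le joint_ge0 andbT -m0; exact: joint_lel.
move: t0t; rewrite le_eqVlt => /predU1P[->|t0t].
  under eq_bigr do rewrite joint_refl.
  rewrite (bigD1 a) //= eqxx mul1r big1 ?addr0; last first.
    by move=> s sa; rewrite eq_sym (negbTE sa) !mul0r.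
  have [m0|m0] := eqVneq (pr P [set w | M t w = a]) 0.
    by rewrite null// m0 mul0r.
  by rewrite mulrCA divff ?mulr1.
have mJ : measurable [set w | (M t0 w, M u w) = (a, x)].
  by apply: fin_measurable_pair => z; exact: mM.
rewrite /joint (pr_fibers P (mM t) mJ); apply: eq_bigr => s _.
have -> : [set w | (M t0 w, M u w) = (a, x)] `&` [set w | M t w = s] =
    cyl M [:: (u, x), (t, s) & [:: (t0, a)]].
  apply/seteqP; split => w /=; rewrite /cyl/=.
    by move=> [[-> ->] ->]; rewrite !eqxx.
  by move=> /and4P[/eqP-> /eqP-> /eqP->].
have /= := @markovM [:: (t0, a)] t u s x _ (le_trans t00 (ltW t0t)) tu.
rewrite t00 t0t => /(_ isT).
rewrite -!joint_cyl (_ : cyl M [:: (t, s)] = [set w | M t w = s]); last first.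
  by apply/seteqP; split => w; rewrite /cyl/= andbT => /eqP.
have [m0 _|m0 eqM] := eqVneq (pr P [set w | M t w = s]) 0.
  rewrite m0 invr0 !mulr0; apply/eqP; rewrite eq_le pr_ge0 andbT -m0.
  apply: le_pr => //; first exact: measurable_cyl.
  by rewrite /cyl => w /= /and4P[_ /eqP->].
by rewrite mulrA -/(joint P M t0 t a s) -/(joint P M t u s x) -eqM mulfK.
Qed.

(** The inversion table determines the permutation, so the event splits into one event for each
    coordinate. *)
Lemma joint_indep (t u : R) (s x : 'S_n) : independent_inversions P M ->
  0 <= t -> 0 <= u ->
  joint P M t u s x = \prod_(j < n) pr P
    [set w | inv_j (M t w) j = inv_j s j /\ inv_j (M u w) j = inv_j x j].
Proof.
move=> indep t0 u0.
pose a j i := if i == 0%N then inv_j s j else inv_j x j.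
have := indep [:: t; u] a; rewrite /= t0 u0 => /(_ isT) indepE.
transitivity (pr P [set w | forall (j : 'I_n) (i : nat), (i < 2)%N ->
    inv_j (M (nth 0 [:: t; u] i) w) j = a j i]).
  congr pr; apply/seteqP; split => w /=.
    by move=> [E0 E1] j [|[|//]] _; rewrite /a /= ?E0 ?E1.
  move=> E; congr pair; apply: inv_j_inj => j; first exact: (E j 0%N).
  exact: (E j 1%N).
rewrite indepE; apply: eq_bigr => j _; congr pr; apply/seteqP; split => w /=.
  by move=> E; split; [exact: (E 0%N)|exact: (E 1%N)].
by move=> [E0 E1] [|[|]].
Qed.

End Markov.

(** * Comparison of two regular Mallows processes *)

Section Uniqueness.
Context (R : realType) (n : nat).
Context (d1 : measure_display) (T1 : measurableType d1) (P1 : probability T1 R)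
  (M1 : R -> T1 -> 'S_n).
Context (d2 : measure_display) (T2 : measurableType d2) (P2 : probability T2 R)
  (M2 : R -> T2 -> 'S_n).
Hypotheses (cm1 : cadlag_markov_process P1 M1) (reg1 : regular_mallows P1 M1).
Hypotheses (cm2 : cadlag_markov_process P2 M2) (reg2 : regular_mallows P2 M2).

Let mM1 : is_process M1. Proof. by case: cm1. Qed.
Let mM2 : is_process M2. Proof. by case: cm2. Qed.
Let markov1 : markov_property P1 M1. Proof. by case: cm1 => _ []. Qed.
Let markov2 : markov_property P2 M2. Proof. by case: cm2 => _ []. Qed.
Let cadlag1 : {ae P1, forall w, cadlag (M1^~ w)}.
Proof. by case: cm1 => _ []. Qed.
Let cadlag2 : {ae P2, forall w, cadlag (M2^~ w)}.
Proof. by case: cm2 => _ []. Qed.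
Let smooth1 : {ae P1, forall w, smooth (M1^~ w)}.
Proof. by case: reg1 => _ [_ [_ []]]. Qed.
Let smooth2 : {ae P2, forall w, smooth (M2^~ w)}.
Proof. by case: reg2 => _ [_ [_ []]]. Qed.
Let indep1 : independent_inversions P1 M1.
Proof. by case: reg1 => _ [_ [_ [_ ]]]. Qed.
Let indep2 : independent_inversions P2 M2.
Proof. by case: reg2 => _ [_ [_ [_ ]]]. Qed.

Lemma marginal_eq t s : 0 <= t ->
  pr P1 [set w | M1 t w = s] = pr P2 [set w | M2 t w = s].
Proof.
by move=> t0; case: reg1 => _ [-> // _]; case: reg2 => _ [-> // _].
Qed.

Let dist (t u : R) : R :=
  \sum_a \sum_x `|joint P1 M1 t u a x - joint P2 M2 t u a x|.

(** Errors add up under composition of transitions. The error over [[t, u]] is counted once for each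
    initial state [a], whence the factor [#|'S_n|]. *)
Lemma dist_step t0 t u : 0 <= t0 -> t0 <= t -> t < u ->
  dist t0 u <= dist t0 t + #|'S_n|%:R * dist t u.
Proof.
move=> t00 t0t tu.
have tge0 := le_trans t00 t0t.
pose m s := pr P1 [set w | M1 t w = s].
have m2E s : pr P2 [set w | M2 t w = s] = m s by rewrite -marginal_eq.
pose J1 := joint P1 M1; pose J2 := joint P2 M2.
have m_div s : m s / m s <= 1.
  by have [->|?] := eqVneq (m s) 0; rewrite ?mul0r// divff.
have term a s x :
  `|J1 t0 t a s * (J1 t u s x / m s) - J2 t0 t a s * (J2 t u s x / m s)| <=
  `|J1 t0 t a s - J2 t0 t a s| * (J1 t u s x / m s) +
  `|J1 t u s x - J2 t u s x|.
  (* The coefficient [J1 t u s x / m s] sums over [x] to at most [1], and [J2 t0 t a s / m s] is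
     itself at most [1]. *)
  rewrite (_ : _ - _ = (J1 t0 t a s - J2 t0 t a s) * (J1 t u s x / m s) +
    J2 t0 t a s / m s * (J1 t u s x - J2 t u s x)); last by ring.
  have J1m : 0 <= J1 t u s x / m s.
    by rewrite mulr_ge0 ?joint_ge0 ?invr_ge0 ?pr_ge0.
  have J2m : 0 <= J2 t0 t a s / m s.
    by rewrite mulr_ge0 ?joint_ge0 ?invr_ge0 ?pr_ge0.
  apply: le_trans (ler_normD _ _) _; apply: lerD.
    by rewrite normrM (ger0_norm J1m).
  rewrite normrM (ger0_norm J2m) ler_piMl//; apply: le_trans (m_div s).
  rewrite ler_wpM2r ?invr_ge0 ?pr_ge0// -m2E -(sum_jointl P2 mM2 t0).
  by rewrite (bigD1 a)//= lerDl sumr_ge0// => a' _; exact: joint_ge0.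
rewrite /dist.
apply: (@le_trans _ _ (\sum_a \sum_x \sum_s
  (`|J1 t0 t a s - J2 t0 t a s| * (J1 t u s x / m s) +
  `|J1 t u s x - J2 t u s x|))).
  apply: ler_sum => a _; apply: ler_sum => x _.
  rewrite (joint_step mM1 markov1 a x t00 t0t tu).
  rewrite (joint_step mM2 markov2 a x t00 t0t tu) -sumrB.
  apply: le_trans (ler_norm_sum _ _ _) _; apply: ler_sum => s _.
  by rewrite m2E; exact: term.
under eq_bigr => a _ do rewrite exchange_big/=.
under eq_bigr => a _ do under eq_bigr => s _ do rewrite big_split/=.
under eq_bigr => a _ do rewrite big_split/=.
rewrite big_split/= lerD//; last first.
  by rewrite sumr_const mulr_natl.
apply: ler_sum => a _; apply: ler_sum => s _.
rewrite -mulr_sumr ler_piMr// -mulr_suml sum_jointr//.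
exact: m_div.
Qed.

(** Both joint laws are products over the coordinates, and [coord_close] puts the factors of both
    close to the same combination of marginals. *)
Lemma joint_dist_le t u a x : 0 <= t -> t < u ->
  `|joint P1 M1 t u a x - joint P2 M2 t u a x| <=
  n%:R * (jump2 P1 M1 t u + jump2 P2 M2 t u).
Proof.
move=> t0 tu; have u0 := le_trans t0 (ltW tu).
rewrite !joint_indep//.
have pr01 dd (TT : measurableType dd) (PP : probability TT R) A :
    measurable A -> 0 <= pr PP A <= 1.
  by move=> mA; rewrite pr_ge0 -(prT PP) le_pr.
have mK dd (TT : measurableType dd) (M : R -> TT -> 'S_n) j k l :
    is_process M ->
    measurable [set w | inv_j (M t w) j = k /\ inv_j (M u w) j = l].
  move=> mM; have mMM : fin_measurable (fun w => (M t w, M u w)).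
    by apply: fin_measurable_pair => z; exact: mM.
  rewrite (_ : [set _ | _] = [set w | (inv_j (M t w) j == k) &&
    (inv_j (M u w) j == l)]).
    exact: (fin_measurable_pred (fun p : 'S_n * 'S_n =>
      (inv_j p.1 j == k) && (inv_j p.2 j == l)) mMM).
  by apply/seteqP; split => w /= => [[-> ->]|/andP[/eqP-> /eqP->]];
    rewrite ?eqxx.
apply: le_trans (ler_dist_prod _ _ _) _.
- by move=> j; apply: pr01; exact: mK.
- by move=> j; apply: pr01; exact: mK.
rewrite -[n in n%:R]card_ord -sumr_const mulr_suml; apply: ler_sum => j _.
rewrite mul1r.
have c1 := coord_close mM1 smooth1 j (inv_j a j) (inv_j x j) t0 tu.
have c2 := coord_close mM2 smooth2 j (inv_j a j) (inv_j x j) t0 tu.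
rewrite distrC in c2.
have e v (g : 'S_n -> R) : 0 <= v ->
    fexp P1 setT (M1 v) g = fexp P2 setT (M2 v) g.
  by move=> v0; apply: eq_bigr => s _; rewrite !setTI marginal_eq.
rewrite !e// in c1.
apply: le_trans (lerD c1 c2); exact: ler_distD.
Qed.

Lemma joint_eq t u a x : 0 <= t -> t < u ->
  joint P1 M1 t u a x = joint P2 M2 t u a x.
Proof.
move=> t0 tu.
pose S : R := #|'S_n|%:R.
(* One factor [S] comes from [dist_step], two from the double sum in [dist], and [n] from
   [joint_dist_le]. *)
pose C := S * (S * (S * n%:R)).
have grid_dist N k : (k <= N.+1)%N -> dist t (grid t u N k) <= C *
    (\sum_(0 <= i < k) (jump2 P1 M1 (grid t u N i) (grid t u N i.+1) +
                        jump2 P2 M2 (grid t u N i) (grid t u N i.+1))).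
  elim: k => [_|k IH kN].
    rewrite big_geq// mulr0 grid0 /dist big1// => s _; rewrite big1// => y _.
    by rewrite !joint_refl// marginal_eq// subrr normr0.
  rewrite big_nat_recr//= mulrDr.
  have tk := grid_ge tu N k; have kk := grid_lt tu N (ltnSn k).
  have g0 := le_trans t0 tk.
  apply: le_trans (dist_step t0 tk kk) _.
  apply: lerD; first by apply: IH; exact: ltnW.
  rewrite /C -mulrA ler_wpM2l ?ler0n// /dist /S -!mulrA.
  rewrite 2!mulr_natl -2!sumr_const; apply: ler_sum => s _.
  by apply: ler_sum => y _; exact: joint_dist_le.
have C0 : 0 <= C by rewrite /C /S !mulr_ge0 ?ler0n.
have small e : 0 < e -> dist t u <= C * ((n * n)%:R * (e + e)).
  move=> e0.
  have [N1 jump1] := grid_jump2_cvg0 mM1 cadlag1 smooth1 t0 tu e0.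
  have [N2 jump2] := grid_jump2_cvg0 mM2 cadlag2 smooth2 t0 tu e0.
  pose N := maxn N1 N2.
  rewrite -{1}(gridN t u N); apply: le_trans (grid_dist N _ (leqnn _)) _.
  rewrite ler_wpM2l// big_split/= mulrDr.
  apply: lerD; apply: le_trans (sum_grid_jump2 _ _ _ _ _) _ => //;
    rewrite ler_wpM2l ?ler0n//; apply: ltW.
    by apply: jump1; exact: leq_maxl.
  by apply: jump2; exact: leq_maxr.
have dist0 : dist t u <= 0.
  apply/ler_addgt0Pr => e e0; rewrite add0r.
  (* The added [1] makes [K] positive, so that it can be divided by. *)
  pose K := C * (n * n)%:R + 1.
  have K0 : 0 < K by rewrite ltr_wpDl// mulr_ge0// ler0n.
  have := small (e / (2 * K)); rewrite divr_gt0 ?mulr_gt0// => /(_ isT) le1.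
  apply: le_trans le1 _.
  rewrite mulrA (_ : e / (2 * K) + e / (2 * K) = e / K); last first.
    by field; rewrite gt_eqF.
  rewrite mulrCA.
  by rewrite ler_piMr ?(ltW e0)// ler_pdivrMr// mul1r /K lerDl.
apply/eqP; rewrite -subr_eq0 -normr_le0; apply: le_trans dist0.
rewrite /dist (bigD1 a)//= (bigD1 x)//= -addrA lerDl addr_ge0 ?sumr_ge0//.
by move=> s _; rewrite sumr_ge0.
Qed.

Lemma cyl_perm dd (TT : measurableType dd) (M : R -> TT -> 'S_n) ts ts' :
  perm_eq ts ts' -> cyl M ts = cyl M ts'.
Proof. by move=> tt'; apply/seteqP; split => w; rewrite /cyl/= (perm_all _ tt'). Qed.

Lemma cyl_dup dd (TT : measurableType dd) (M : R -> TT -> 'S_n) p ts :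
  cyl M [:: p, p & ts] = cyl M (p :: ts).
Proof. by apply/seteqP; split => w; rewrite /cyl/= andbA andbb. Qed.

Lemma cyl_conflict dd (TT : measurableType dd) (M : R -> TT -> 'S_n) t s s' ts :
  s != s' -> cyl M [:: (t, s), (t, s') & ts] = set0.
Proof.
move=> ss'; apply/seteqP; split => // w; rewrite /cyl/= => /and3P[/eqP Es].
by rewrite Es (negbTE ss').
Qed.

(** Induction on the number of times, the latest first. The Markov property expresses a cylinder by
    a shorter one and a two-time law. It needs a strict past, so equal times are treated apart; so
    are states without mass, where both sides vanish. *)
Lemma same_law_sorted ts : nonneg_times ts ->
  sorted (fun p q => q.1 <= p.1) ts -> pr P1 (cyl M1 ts) = pr P2 (cyl M2 ts).
Proof.
have [k] := ubnP (size ts); elim: k ts => // k IH.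
have cyl1 dd (TT : measurableType dd) (M : R -> TT -> 'S_n) t s :
    cyl M [:: (t, s)] = [set w | M t w = s].
  by apply/seteqP; split => w; rewrite /cyl/= andbT => /eqP.
have tr : transitive (fun p q : R * 'S_n => q.1 <= p.1).
  by move=> p q r /= qp rq; exact: le_trans rq qp.
case=> [|[u x] [|[t s] ts]] sz; rewrite /nonneg_times.
- by rewrite !cyl_nil !prT.
- by rewrite /= andbT => u0 _; rewrite !cyl1 marginal_eq.
move=> /= /and3P[u0 t0 ts0] /andP[tu srt].
have rest_eq : pr P1 (cyl M1 ((t, s) :: ts)) = pr P2 (cyl M2 ((t, s) :: ts)).
  by apply: IH => //; rewrite /nonneg_times/= t0.
move: tu; rewrite le_eqVlt => /predU1P[<-{u u0 sz}|tu].
  have [->|xs] := eqVneq x s; first by rewrite !cyl_dup.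
  by rewrite !cyl_conflict// !pr0.
have [past|] := boolP (all (fun p : R * 'S_n => (0 <= p.1) && (p.1 < t)) ts).
  have e1 := markov1 s x past t0 tu; have e2 := markov2 s x past t0 tu.
  rewrite -!joint_cyl !cyl1 in e1 e2.
  have [m0|m0] := eqVneq (pr P1 [set w | M1 t w = s]) 0; last first.
    apply: (mulIf m0); rewrite e1 {1}marginal_eq// e2.
    by rewrite rest_eq joint_eq.
  have m0' : pr P2 [set w | M2 t w = s] = 0 by rewrite -marginal_eq.
  transitivity (0 : R); [|apply/esym]; apply/eqP; rewrite eq_le pr_ge0 andbT.
    rewrite -m0; apply: le_pr => //; first exact: measurable_cyl.
    by rewrite /cyl => w /= /and3P[_ /eqP->].
  rewrite -m0'; apply: le_pr => //; first exact: measurable_cyl.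
  by rewrite /cyl => w /= /and3P[_ /eqP->].
case: ts sz ts0 srt rest_eq => // -[v y] ts sz ts0 /= /andP[vt srt] rest_eq.
move: vt; rewrite le_eqVlt => /predU1P[vt _|vt /negP[]]; last first.
  move: ts0 => /= /andP[-> ts0]; rewrite vt/=; apply/allP => p pts.
  rewrite (allP ts0 p pts)/=; apply: le_lt_trans vt.
  exact: (allP (order_path_min tr srt) p pts).
(* The second and third times coincide: either their states conflict and the event is empty, or one
   of them is a duplicate, whose removal shortens the list. *)
have swap dd (TT : measurableType dd) (M : R -> TT -> 'S_n) :
    cyl M [:: (u, x), (t, s), (v, y) & ts] =
    cyl M [:: (t, s), (v, y), (u, x) & ts].
  by apply/seteqP; split => w; rewrite /cyl/= => /and4P[-> -> -> ->].
rewrite !swap vt; have [->|sy] := eqVneq s y; last first.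
  by rewrite !cyl_conflict// !pr0.
have swap' dd (TT : measurableType dd) (M : R -> TT -> 'S_n) :
    cyl M [:: (t, y), (u, x) & ts] = cyl M [:: (u, x), (t, y) & ts].
  by apply/seteqP; split => w; rewrite /cyl/= => /and3P[-> -> ->].
rewrite !cyl_dup !swap'; apply: IH => //=.
  by rewrite /nonneg_times/= u0 t0; move: ts0 => /= /andP[].
by rewrite ltW//= -vt.
Qed.

Lemma regular_mallows_same_law : same_law P1 M1 P2 M2.
Proof.
move=> ts ts0; pose r (p q : R * 'S_n) := q.1 <= p.1.
have srt : perm_eq ts (sort r ts) by rewrite perm_sym perm_sort.
rewrite !(cyl_perm _ srt); apply: same_law_sorted.
  by rewrite /nonneg_times -(perm_all _ srt).
by apply: sort_sorted => p q; rewrite /r le_total.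
Qed.

End Uniqueness.

(** * Jump rates *)

Section Geometric.
Context (R : realType).

(** A polynomial rather than a function, so that differentiation and the division by ['X^k] are
    algebraic. *)
Definition geo (m : nat) : {poly R} := \sum_(l < m) 'X^l.

Lemma geoE m t : (geo m).[t] = \sum_(l < m) t ^+ l.
Proof. by rewrite horner_sum; apply: eq_bigr => l _; rewrite hornerXn. Qed.

Lemma geoS m : geo m.+1 = geo m + 'X^m.
Proof. by rewrite /geo big_ord_recr. Qed.

Lemma geo_recl m t : (geo m.+1).[t] = 1 + t * (geo m).[t].
Proof.
rewrite !geoE big_ord_recl expr0 mulr_sumr; congr (_ + _).
by apply: eq_bigr => l _; rewrite -exprS.
Qed.

Lemma geo_ge0 m t : 0 <= t -> 0 <= (geo m).[t].
Proof. by move=> t0; rewrite geoE sumr_ge0// => l _; rewrite exprn_ge0. Qed.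

Lemma geo_gt0 m t : 0 <= t -> 0 < (geo m.+1).[t].
Proof. by move=> t0; rewrite geo_recl ltr_wpDr// mulr_ge0// geo_ge0. Qed.

Lemma geo_le m m' t : 0 <= t -> (m <= m')%N -> (geo m).[t] <= (geo m').[t].
Proof.
move=> t0 /subnK <-; elim: (m' - m)%N => // i IH; rewrite addSn geoS hornerD.
by rewrite (le_trans IH)// lerDl hornerXn exprn_ge0.
Qed.

(* The rate at which the chain on [{0..j}] leaves level [k] is
   [(geo k.+1 * (geo j.+1)' - (geo k.+1)' * geo j.+1) / (X^k * geo j.+1)];
   [rate_num] is the numerator after the exact division by [X^k]. *)
Definition rate_num (j k : nat) : {poly R} :=
  \sum_(a < k.+1) \sum_(k.+1 <= b < j.+1) 'X^(a + b.-1 - k) *+ (b - a).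

(** The left side is antisymmetric in the two polynomials, so the terms of [geo j.+1] already in
    [geo k.+1] cancel. Each pair [a <= k < b] leaves [b - a] times ['X^(a + b - 1)], which ['X^k]
    divides. *)
Lemma rate_numE j k : (k < j)%N ->
  geo k.+1 * (geo j.+1)^`() - (geo k.+1)^`() * geo j.+1
  = rate_num j k * 'X^k.
Proof.
move=> kj.
have -> : geo j.+1 = geo k.+1 + \sum_(k.+1 <= b < j.+1) 'X^b.
  by rewrite /geo -!(big_mkord xpredT (fun l => 'X^l)) -big_cat_nat //= ltnW.
rewrite derivD mulrDr mulrDr (mulrC (geo k.+1)^`() (geo k.+1)).
rewrite opprD addrACA subrr add0r /rate_num /geo.
rewrite !(raddf_sum (@deriv R)) /= !mulr_suml -sumrB.
apply: eq_bigr => a _.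
rewrite !mulr_sumr -sumrB mulr_suml.
rewrite !big_nat; apply: eq_bigr => b /andP[kb bj].
have ak := ltn_ord a; rewrite ltnS in ak.
rewrite !derivXn mulrnAr -exprD mulrnAl -exprD mulrnAl -exprD subnK; last by lia.
rewrite mulrnBr; last by lia.
congr (_ - _); case: (val a) ak => [|a'] ak; first by rewrite !mulr0n.
by congr (_ *+ _); congr ('X^_); lia.
Qed.

(** The pair [a = 0], [b = k.+1] contributes the constant [k.+1], which keeps the rate positive even
    at time [0]. *)
Lemma rate_num_gt0 j k t : (k < j)%N -> 0 <= t -> 0 < (rate_num j k).[t].
Proof.
move=> kj t0.
have ge0 (a b : nat) : 0 <= ('X^(a + b.-1 - k) *+ (b - a) : {poly R}).[t].
  by rewrite hornerMn hornerXn mulrn_wge0// exprn_ge0.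
rewrite /rate_num horner_sum big_ord_recl ltr_pwDl//; last first.
  apply: sumr_ge0 => a _; rewrite horner_sum big_nat; apply: sumr_ge0 => b _.
  exact: ge0.
rewrite horner_sum big_ltn ?ltnS// ltr_pwDl//.
  by rewrite hornerMn hornerXn add0n /= subnn expr0 subn0 ltr0n.
by rewrite big_nat; apply: sumr_ge0 => b _; exact: ge0.
Qed.

(* The probability that a coordinate with values in [{0..j}] and weights
   proportional to [t ^+ l] is at least [k]. *)
Definition tail (j k : nat) (t : R) : R := 1 - (geo k).[t] / (geo j.+1).[t].

Lemma tail0 j t : tail j 0 t = 1.
Proof. by rewrite /tail geoE big_ord0 mul0r subr0. Qed.

Lemma tail_last j t : 0 <= t -> tail j j.+1 t = 0.
Proof. by move=> t0; rewrite /tail divff ?subrr// gt_eqF// geo_gt0. Qed.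

Lemma tail_at0 j k : tail j k.+1 0 = 0.
Proof. by rewrite /tail !geo_recl !mul0r !addr0 divr1 subrr. Qed.

Lemma tail_le1 j k t : 0 <= t -> tail j k t <= 1.
Proof.
by move=> t0; rewrite gerBl divr_ge0// ?geo_ge0.
Qed.

Lemma tail_ge0 j k t : 0 <= t -> (k <= j.+1)%N -> 0 <= tail j k t.
Proof.
move=> t0 kj; rewrite subr_ge0 ler_pdivrMr ?geo_gt0// mul1r.
exact: geo_le.
Qed.

Lemma tailB j k t : tail j k t - tail j k.+1 t = t ^+ k / (geo j.+1).[t].
Proof. by rewrite /tail (geoS k) hornerD hornerXn; ring. Qed.

Definition rate (j k : nat) (t : R) : R :=
  (rate_num j k).[t] / (geo j.+1).[t].

(** The forward equation of the birth chain. The power ['X^k] split off in [rate_numE] is the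
    numerator of the point probability in [tailB]. *)
Lemma is_derive_tail j k (t : R) : (k < j)%N -> 0 <= t ->
  is_derive t 1 (tail j k.+1) (rate j k t * (tail j k t - tail j k.+1 t)).
Proof.
move=> kj t0; have S0 : (geo j.+1).[t] != 0 by rewrite gt_eqF// geo_gt0.
have dA := is_derive_poly (geo k.+1) t.
have dS := is_deriveV S0 (is_derive_poly (geo j.+1) t).
have dAS := is_deriveM dA dS.
have := is_deriveB (is_derive_cst (1 : R) t 1) dAS.
rewrite tailB /rate.
move=> /is_derive_eq; apply.
have := congr1 (fun p : {poly R} => p.[t]) (rate_numE kj).
rewrite !(hornerD, hornerM, hornerN, hornerXn) => numE.
rewrite /GRing.scale /=.
rewrite mulrACA -numE; field; exact: S0.
Qed.

End Geometric.

(** * Survival functions of the successive levels *)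

Section Hazard.
Context (R : realType).
Local Notation mu := (@lebesgue_measure R).

Lemma FTC_is_derive (f F : R -> R) (a b : R) : a <= b -> continuous f ->
  (forall x, a <= x -> x <= b -> is_derive x 1 F (f x)) ->
  (\int[mu]_(x in `[a, b]) (f x)%:E = (F b - F a)%:E)%E.
Proof.
move=> + cf dF; rewrite le_eqVlt => /predU1P[<-|ab].
  by rewrite set_itv1 integral_set1 subrr.
have cF x : a <= x -> x <= b -> {for x, continuous F}.
  move=> ax xb; apply: differentiable_continuous; apply/derivable1_diffP.
  by have := dF x ax xb => -[].
rewrite (@continuous_FTC2 _ f F a b ab)//.
- exact: continuous_subspaceT.
- split.
  + move=> x; rewrite in_itv/= => /andP[ax xb].
    by have := dF x (ltW ax) (ltW xb) => -[].
  + by apply: cvg_at_right_filter; apply: cF => //; exact: ltW.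
  + by apply: cvg_at_left_filter; apply: cF => //; exact: ltW.
- move=> x; rewrite in_itv/= => /andP[ax xb]; rewrite derive1E.
  by have := dF x (ltW ax) (ltW xb) => -[].
Qed.

(* A point at level [k] since time [s] is still there at time [u] with
   probability [G u / G s]; [q / G^-1] is the jump rate.  [F0] and [F1] are the
   distribution functions of the arrival times at levels [k] and [k.+1]. *)
Record hazard (F0 F1 G q : R -> R) : Prop := Hazard {
  hazard_continuous : continuous G;
  hazard_gt0 : forall x, 0 < G x;
  hazard_density_continuous : continuous q;
  hazard_density_ge0 : forall x, 0 <= q x;
  hazard_decr : forall s t, 0 <= s -> s < t -> G t < G s;
  hazard_small : forall e, 0 < e -> exists2 t, 0 <= t & G t < e;
  hazard_integral : forall s u, 0 <= s -> s <= u ->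
    (\int[mu]_(v in `[s, u]) (q v)%:E = ((G u)^-1 - (G s)^-1)%:E)%E;
  hazard_tail : forall u, 0 <= u ->
    (\int[mu]_(v in `[0%R, u]) (F0 v * q v)%:E = (F1 u / G u)%:E)%E }.

(** Replacing [x] by its absolute value extends functions that are well behaved on nonnegative times
    to continuous functions on the line. *)
Lemma continuous_norm_comp (f : R -> R) : (forall x, 0 <= x -> {for x, continuous f}) ->
  continuous (fun x : R => f `|x|).
Proof.
move=> cf x; apply: (@continuous_comp _ _ _ (fun x : R => `|x|) f).
  exact: norm_continuous.
by apply: cf.
Qed.

(** Applied with [a = -1], to have a two-sided derivative at time [0]. *)
Lemma primitive_exists (a : R) (f : R -> R) : continuous f ->
  exists F : R -> R, forall x : R, a < x -> is_derive x 1 F (f x).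
Proof.
move=> cf; exists (fun x => \int[mu]_(t in `[a, x]) f t)%R => x ax.
have xx1 : x < x + 1 by rewrite ltrDl.
have intf : mu.-integrable `[a, x + 1] (EFin \o f).
  apply: continuous_compact_integrable; first exact: segment_compact.
  exact: continuous_subspaceT.
have [dF F'] := continuous_FTC1_closed xx1 intf ax (cf x).
by rewrite -F' derive1E; exact/derivableP.
Qed.

(** [G] is the exponential of minus a primitive of the rate, and [q] is the derivative of [G^-1]. By
    the forward equation the derivative of [tail j k.+1 / G] is [tail j k * q], which yields
    [hazard_tail]. *)
Lemma hazard_exists (j k : nat) : (k < j)%N ->
  exists G q, hazard (@tail R j k) (tail j k.+1) G q.
Proof.
move=> kj.
have geo_neq0 x : 0 <= x -> (geo R j.+1).[x] != 0.
  by move=> x0; rewrite gt_eqF// geo_gt0.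
have cgeo i x : 0 <= x -> {for x, continuous (fun y => (geo R i).[y] / (geo R j.+1).[y])}.
  move=> x0; apply: continuousM; first exact: continuous_horner.
  by apply: continuousV; [exact: geo_neq0|exact: continuous_horner].
pose r (x : R) := rate j k `|x|.
have cr : continuous r.
  apply: continuous_norm_comp => x x0.
  apply: continuousM; first exact: continuous_horner.
  by apply: continuousV; [exact: geo_neq0|exact: continuous_horner].
have r_gt0 x : 0 < r x by rewrite divr_gt0 ?rate_num_gt0 ?geo_gt0.
have [G0 G0_gt0 dG0] : exists2 G0 : R -> R, forall x, 0 < G0 x &
    forall x : R, -1 < x -> is_derive x 1 G0 (- (r x * G0 x)).
  have [L dL] := primitive_exists (-1) cr.
  exists (fun x => expR (- L x)) => [x|x x1]; first exact: expR_gt0.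
  have := @is_derive1_comp R expR (- L) x _ _ (is_derive_expR _)
    (is_deriveN (dL x x1)).
  by move=> /is_derive_eq; apply; rewrite mulrN mulrC.
have G0_neq0 x : G0 x != 0 by rewrite gt_eqF.
have cG0 (x : R) : -1 < x -> {for x, continuous G0}.
  move=> x1; apply: differentiable_continuous; apply/derivable1_diffP.
  by have := dG0 x x1 => -[].
have gtN1 (x : R) : 0 <= x -> -1 < x by apply: lt_le_trans; rewrite oppr_lt0.
have dVG0 (x : R) : -1 < x -> is_derive x 1 (fun y => (G0 y)^-1) (r x / G0 x).
  move=> x1; have := is_deriveV (G0_neq0 x) (dG0 x x1).
  move=> /is_derive_eq; apply; rewrite /GRing.scale /=.
  by field; exact: G0_neq0.
pose G (x : R) := G0 `|x|.
pose q (x : R) := r x / G x.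
have Gge x : 0 <= x -> G x = G0 x by move=> x0; rewrite /G ger0_norm.
have cG : continuous G.
  by apply: continuous_norm_comp => x x0; apply: cG0; exact: gtN1.
have G_neq0 x : G x != 0 by exact: G0_neq0.
have cq : continuous q.
  move=> x; apply: continuousM; first exact: cr.
  by apply: continuousV; [exact: G_neq0|exact: cG].
have q_ge0 x : 0 <= q x by rewrite divr_ge0// ltW// G0_gt0.
have decr s t : 0 <= s -> s < t -> G t < G s.
  move=> s0 st; have t0 := ltW (le_lt_trans s0 st).
  rewrite !Gge// -subr_lt0.
  have [|||c] := @MVT R G0 (fun x => - (r x * G0 x)) s t => //.
  - move=> x; rewrite in_itv/= => /andP[sx _]; apply/dG0/gtN1.
    exact: le_trans s0 (ltW sx).
  - apply: derivable_within_continuous => x; rewrite in_itv/= => /andP[sx _].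
    by have := dG0 x (gtN1 x (le_trans s0 sx)) => -[].
  - by move=> _ ->; rewrite mulNr oppr_lt0 mulr_gt0 ?subr_gt0// mulr_gt0.
have intq s u : 0 <= s -> s <= u ->
    (\int[mu]_(v in `[s, u]) (q v)%:E = ((G u)^-1 - (G s)^-1)%:E)%E.
  move=> s0 su.
  have dq (x : R) : s <= x -> x <= u ->
      is_derive x 1 (fun y => (G0 y)^-1) (q x).
    move=> sx _; rewrite /q Gge ?(le_trans s0)//.
    by apply/dVG0/gtN1/(le_trans s0).
  by rewrite (FTC_is_derive su cq dq) !Gge// (le_trans s0 su).
pose tq (x : R) := tail j k `|x| * q x.
have ctq : continuous tq.
  move=> x; apply: (@continuousM _ _ (fun y : R => tail j k `|y|) q); last exact: cq.
  apply: (continuous_norm_comp (f := tail j k)) => {}x x0.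
  by apply: continuousB; [exact: cst_continuous|exact: cgeo].
have tqE u : (\int[mu]_(v in `[0%R, u]) (tail j k v * q v)%:E =
    \int[mu]_(v in `[0%R, u]) (tq v)%:E)%E.
  apply: eq_integral => v; rewrite inE/= in_itv/= => /andP[v0 _].
  by rewrite /tq ger0_norm.
have inttq u : 0 <= u ->
    (\int[mu]_(v in `[0%R, u]) (tail j k v * q v)%:E = (tail j k.+1 u / G u)%:E)%E.
  move=> u0; rewrite tqE.
  have dtq (x : R) : 0 <= x -> x <= u ->
      is_derive x 1 (fun y => tail j k.+1 y * (G0 y)^-1) (tq x).
    move=> x0 _; have := is_deriveM (is_derive_tail kj x0) (dVG0 x (gtN1 x x0)).
    move=> /is_derive_eq; apply.
    rewrite /GRing.scale /= /tq /q Gge// /r ger0_norm//.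
    by ring.
  by rewrite (FTC_is_derive u0 ctq dtq) !Gge// tail_at0 mul0r subr0.
exists G, q; split => //; first by move=> x; exact: G0_gt0.
move=> e e0.
(* Since [tail j k <= 1], comparing the integrals of [tail j k * q] and [q] bounds [(G 0)^-1] by
   [(1 - tail j k.+1 t) / G t]. The numerator is a ratio of geometric sums with [k < j], hence at
   most [t^-1]. *)
have bound t : 0 < t -> G t <= G 0 / t.
  move=> t0.
  have : (\int[mu]_(v in `[0%R, t]) (tail j k v * q v)%:E <=
          \int[mu]_(v in `[0%R, t]) (q v)%:E)%E.
    rewrite tqE; apply: ge0_le_integral => //=.
    - move=> v; rewrite in_itv/= => /andP[v0 _]; rewrite lee_fin mulr_ge0//.
      by rewrite tail_ge0 ?normr_ge0// ltnW// ltnW.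
    - by apply/measurable_EFinP/measurable_funTS; exact: continuous_measurable_fun.
    - by apply/measurable_EFinP/measurable_funTS; exact: continuous_measurable_fun.
    - move=> v _; rewrite lee_fin ler_piMl// tail_le1 ?normr_ge0//.
  rewrite (inttq t (ltW t0)) (intq 0 t (lexx 0) (ltW t0)) lee_fin => le1.
  have le2 : (G 0)^-1 <= (1 - tail j k.+1 t) / G t by rewrite mulrBl mul1r; lra.
  have le3 : 1 - tail j k.+1 t <= t^-1.
    rewrite /tail opprB addrCA subrr addr0 (ler_pdivrMr _ _ (geo_gt0 j (ltW t0))).
    rewrite mulrC ler_pdivlMr// (geo_recl j) mulrC.
    apply: (@le_trans _ _ (t * (geo R j).[t])); last by rewrite lerDr.
    by rewrite (ler_pM2l t0) (geo_le (ltW t0)).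
  have le4 : (G 0)^-1 <= t^-1 / G t.
    by apply: le_trans le2 _; rewrite ler_wpM2r// invr_ge0 ltW// G0_gt0.
  rewrite ler_pdivlMr// -[leRHS]invrK -[leLHS]invrK lef_pV2 ?posrE ?invr_gt0//.
  - by rewrite invfM mulrC.
  - by rewrite mulr_gt0// G0_gt0.
  - exact: G0_gt0.
exists (G 0 / e + 1).
  by rewrite addr_ge0// divr_ge0// ltW// G0_gt0.
have p0 : 0 < G 0 / e + 1 by rewrite ltr_wpDl// divr_ge0// ltW// G0_gt0.
apply: le_lt_trans (bound _ p0) _.
rewrite ltr_pdivrMr// mulrDr mulr1 mulrC divfK ?gt_eqF//.
by rewrite ltrDl.
Qed.

End Hazard.

(** * Adding one jump time *)

Section RealVariables.
Context (R : realType) (d : measure_display) (T : measurableType d).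

Lemma measurable_ler_set (f g : T -> R) :
  measurable_fun setT f -> measurable_fun setT g ->
  measurable [set w | f w <= g w].
Proof.
move=> mf mg.
have := measurable_fun_ler mf mg measurableT (_ : measurable [set true]).
by rewrite setTI preimage_true; apply.
Qed.

Lemma measurable_ltr_set (f g : T -> R) :
  measurable_fun setT f -> measurable_fun setT g ->
  measurable [set w | f w < g w].
Proof.
move=> mf mg.
have := measurable_fun_ltr mf mg measurableT (_ : measurable [set true]).
by rewrite setTI preimage_true; apply.
Qed.

Lemma measurable_eqr_set (f g : T -> R) :
  measurable_fun setT f -> measurable_fun setT g ->
  measurable [set w | f w = g w].
Proof.
move=> mf mg; rewrite (_ : [set _ | _] = [set w | f w <= g w] `&` [set w | g w <= f w]).
  by apply: measurableI; exact: measurable_ler_set.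
apply/seteqP; split => w /=; first by move=> ->.
by move=> [fg gf]; apply/eqP; rewrite eq_le fg gf.
Qed.

Lemma measurable_fun_rays (f : T -> R) :
  (forall t, measurable [set w | f w <= t]) -> measurable_fun setT f.
Proof.
move=> mf; apply: (measurability _ (RGenOInfty.measurableE R)).
move=> _ [_ [x ->] <-]; rewrite setTI.
rewrite (_ : _ @^-1` _ = ~` [set w | f w <= x]); first exact: measurableC.
apply/seteqP; split => w /=; rewrite in_itv/= andbT.
  by move=> xf; apply/negP; rewrite -ltNge.
by move=> /negP; rewrite -ltNge.
Qed.

End RealVariables.

(** * Product spaces and uniform variables *)

Section ProductProbability.
Context (R : realType) d1 d2 (T1 : measurableType d1) (T2 : measurableType d2)
  (P1 : probability T1 R) (P2 : probability T2 R).

Definition prod_pr := (P1 \x P2)%E.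

HB.instance Definition _ := Measure.on prod_pr.

Let prod_pr_setT : prod_pr setT = 1%E.
Proof.
rewrite -setXTT; transitivity (P1 setT * P2 setT)%E.
  exact: product_measure1E.
by rewrite !probability_setT mule1.
Qed.

HB.instance Definition _ := Measure_isProbability.Build _ _ R prod_pr prod_pr_setT.

Lemma pr_prod (A : set T1) (B : set T2) : measurable A -> measurable B ->
  pr prod_pr (A `*` B) = pr P1 A * pr P2 B.
Proof.
move=> mA mB; rewrite /pr -fineM ?fin_num_measure//; congr fine.
exact: product_measure1E.
Qed.

Lemma pr_prod_fst (A : set T1) : measurable A ->
  pr prod_pr [set x | A x.1] = pr P1 A.
Proof.
move=> mA; rewrite (_ : [set x | _] = A `*` setT).
  by rewrite pr_prod// prT mulr1.
by apply/seteqP; split => [x Ax|x []].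
Qed.

Lemma pr_prod_snd (B : set T2) : measurable B ->
  pr prod_pr [set x | B x.2] = pr P2 B.
Proof.
move=> mB; rewrite (_ : [set x | _] = setT `*` B).
  by rewrite pr_prod// prT mul1r.
by apply/seteqP; split => [x Bx|x []].
Qed.

Lemma measurable_setX_fst (A : set T1) : measurable A ->
  measurable [set x : T1 * T2 | A x.1].
Proof.
by move=> mA; rewrite -[X in measurable X]setTI; exact: measurable_fst.
Qed.

Lemma measurable_setX_snd (B : set T2) : measurable B ->
  measurable [set x : T1 * T2 | B x.2].
Proof.
by move=> mB; rewrite -[X in measurable X]setTI; exact: measurable_snd.
Qed.

Lemma pr_prod_null (A : set (T1 * T2)) : measurable A ->
  (forall w, pr P2 [set v | A (w, v)] = 0) -> pr prod_pr A = 0.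
Proof.
move=> mA A0; rewrite /pr [X in fine X](_ : _ = 0%E)//.
apply: integral0_eq => w _ /=.
have := A0 w; rewrite /pr (_ : [set v | A (w, v)] = xsection A w).
  move=> /eqP; rewrite fine_eq0; first by move=> /eqP.
  by apply: fin_num_measure; exact: measurable_xsection.
by apply/seteqP; split => v; rewrite /xsection/= inE.
Qed.

End ProductProbability.

Section Uniform.
Context (R : realType).
Local Notation unif := (uniform_prob (@ltr01 R)).

Lemma uniform_prob_itv (c : R) : 0 <= c -> c <= 1 -> unif `]0, c[ = c%:E.
Proof.
move=> c0 c1; rewrite /uniform_prob.
rewrite (eq_integral (cst 1%E)); last first.
  move=> x; rewrite inE/= in_itv/= => /andP[x0 xc].
  by rewrite /uniform_pdf (ltW x0) (le_trans (ltW xc) c1) subr0 invr1.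
rewrite integral_cst//= mul1e lebesgue_measure_itv/= lte_fin.
case: ifPn => [_|]; first by rewrite oppr0 adde0.
by rewrite -leNgt => c0'; congr _%:E; apply/eqP; rewrite eq_le c0.
Qed.

(** Membership in [U] is prescribed on the open unit interval only, as its complement is null;
    placeholder values outside it are thus harmless. *)
Lemma uniform_prob_lt (U : set R) (c : R) : measurable U -> 0 <= c -> c <= 1 ->
  (forall v, 0 < v -> v < 1 -> U v <-> v < c) -> unif U = c%:E.
Proof.
move=> mU c0 c1 Uc.
have out0 : unif (~` `]0, 1[) = 0%E.
  rewrite probability_setC// [X in (1 - X)%E](_ : _ = 1%E) ?subee//.
  exact: uniform_prob_itv.
have split (V : set R) : measurable V -> unif V = unif (V `&` `]0, 1[).
  move=> mV; have mI : measurable (V `&` `]0, 1[) by apply: measurableI.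
  have mD : measurable (V `\` `]0, 1[) by apply: measurableD.
  rewrite -[in LHS](setUIDK V `]0, 1[) measureU//.
    rewrite [X in (_ + X)%E](_ : _ = 0%E) ?adde0//.
    apply/eqP; rewrite eq_le measure_ge0 andbT -out0.
    apply: le_measure; rewrite ?inE//; exact: measurableC.
  by apply/seteqP; split => // v [[_ iv] [_ /(_ iv)]].
rewrite split// -uniform_prob_itv//; congr (unif _).
apply/seteqP; split => v /=; rewrite !in_itv/=.
  by move=> [Uv /andP[v0 v1]]; rewrite v0; apply/Uc.
move=> /andP[v0 vc]; have v1 := lt_le_trans vc c1.
by rewrite v0 v1; split => //; apply/Uc.
Qed.

Lemma pr_uniform_lt (U : set R) (c : R) : measurable U -> 0 <= c -> c <= 1 ->
  (forall v, 0 < v -> v < 1 -> U v <-> v < c) -> pr unif U = c.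
Proof.
by move=> mU c0 c1 Uc; rewrite -[RHS]/(fine c%:E); congr fine; exact: uniform_prob_lt.
Qed.

Lemma pr_uniform1 (c : R) : pr unif [set c] = 0.
Proof.
have /null_content_dominatesP dom := @dominates_uniform_prob R 0 1 ltr01.
rewrite -[RHS]/(fine 0%:E); congr fine; apply: dom; first exact: measurable_set1.
exact: lebesgue_measure_set1.
Qed.

End Uniform.

(** * Law of the next arrival time *)

Section NextTime.
Context (R : realType) (F0 F1 G q : R -> R) (hz : hazard F0 F1 G q).
Local Notation mu := (@lebesgue_measure R).
Local Notation unif := (uniform_prob (@ltr01 R)).

Let G_gt0 := hazard_gt0 hz.

Lemma hazard_le s t : 0 <= s -> 0 <= t -> (G t <= G s) = (s <= t).
Proof.
move=> s0 t0; have [ts|st] := ltP t s.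
  by apply/negbTE; rewrite -ltNge; exact: (hazard_decr hz).
move: st; rewrite le_eqVlt => /predU1P[->|st]; first by rewrite lexx.
by apply: ltW; exact: (hazard_decr hz).
Qed.

(* Inversion of the survival function.  For [v] outside [ ]0, 1[ ] the value
   is a placeholder. *)
Lemma next_time_exists (s v : R) : 0 <= s -> exists xi, [/\ s < xi,
  (0 < v < 1 -> G xi = v * G s) &
  forall t, (xi <= t) =
    if 0 < v < 1 then (s <= t) && (G t <= v * G s) else s + 1 <= t].
Proof.
move=> s0; case: (boolP (0 < v < 1)) => [/andP[v0 v1]|_]; last first.
  by exists (s + 1); rewrite ltrDl.
have vG : v * G s < G s by rewrite gtr_pMl.
have [t1 t10 Gt1] := hazard_small hz (mulr_gt0 v0 (G_gt0 s)).
have st1 : s <= t1.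
  by rewrite -(hazard_le s0 t10) ltW// (lt_trans Gt1).
have [||c] := @IVT R G s t1 (v * G s) st1.
- exact: continuous_subspaceT (hazard_continuous hz).
- by rewrite ge_min le_max (ltW Gt1) (ltW vG) orbT.
rewrite in_itv/= => /andP[sc ct1] Gc.
exists c; split => //.
  by rewrite lt_neqAle sc andbT; apply: contraTneq vG => E; rewrite -Gc E ltxx.
move=> t; have [st|ts] /= := leP s t.
  by rewrite -Gc hazard_le// ?(le_trans s0).
by apply/negbTE; rewrite -ltNge (lt_le_trans ts).
Qed.

Context (d : measure_display) (T : measurableType d) (P : probability T R).
Context (tau : T -> R).
Hypotheses (mtau : measurable_fun setT tau) (tau_ge0 : forall w, 0 <= tau w).
Context (tau' : T * R -> R).
Hypothesis tau'P : forall x, [/\ tau x.1 < tau' x,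
  (0 < x.2 < 1 -> G (tau' x) = x.2 * G (tau x.1)) &
  forall t, (tau' x <= t) =
    if 0 < x.2 < 1 then (tau x.1 <= t) && (G t <= x.2 * G (tau x.1))
    else tau x.1 + 1 <= t].

Let P' := prod_pr P unif.

Let tau_lt x : tau x.1 < tau' x. Proof. by case: (tau'P x). Qed.
Let tau'E x t : (tau' x <= t) =
  if 0 < x.2 < 1 then (tau x.1 <= t) && (G t <= x.2 * G (tau x.1))
  else tau x.1 + 1 <= t.
Proof. by case: (tau'P x). Qed.

Let mG : measurable_fun setT G.
Proof. exact: continuous_measurable_fun (hazard_continuous hz). Qed.

Let mGtau : measurable_fun setT (G \o tau).
Proof. exact: measurableT_comp. Qed.

(** [tau'] is known only through its properties at each point, but these describe its sublevel sets
    explicitly in terms of measurable functions. *)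
Lemma measurable_next_time : measurable_fun setT tau'.
Proof.
apply: measurable_fun_rays => t.
pose D := [set x : T * R | 0 < x.2 < 1].
have m2 : measurable_fun setT (fun x : T * R => x.2) by exact: measurable_snd.
have m1 : measurable_fun setT (fun x : T * R => tau x.1).
  by apply: measurableT_comp => //; exact: measurable_fst.
have mG1 : measurable_fun setT (fun x : T * R => G (tau x.1)).
  by apply: (measurableT_comp mGtau); exact: measurable_fst.
have mD : measurable D.
  rewrite (_ : D = [set x | 0 < x.2] `&` [set x | x.2 < 1]).
    by apply: measurableI; apply: measurable_ltr_set => //; exact: measurable_cst.
  apply/seteqP; split => x; rewrite /D/=; first by move=> /andP[-> ->].
    by move=> [-> ->].
rewrite (_ : [set _ | _] =
    (D `&` ([set x | tau x.1 <= t] `&` [set x | G t <= x.2 * G (tau x.1)]))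
    `|` ((~` D) `&` [set x | tau x.1 + 1 <= t])).
  apply: measurableU; apply: measurableI => //.
  - apply: measurableI; apply: measurable_ler_set => //; try exact: measurable_cst.
    exact: measurable_funM.
  - exact: measurableC.
  - apply: measurable_ler_set; try exact: measurable_cst.
    by apply: measurable_funD => //; exact: measurable_cst.
apply/seteqP; split => x; rewrite /D /= tau'E; case: ifPn => /= v01.
- by move=> /andP[? ?]; left.
- by right.
- by move=> [[_ [-> ->]]|[]].
- by move=> [[]|[]].
Qed.

(** Within the unit interval only [v = G t / G (tau w)] leads to an arrival at [t]. *)
Lemma next_time_atomless w t : pr unif [set v | tau' (w, v) = t] = 0.
Proof.
pose c := G t / G (tau w).
have mU : measurable [set v | tau' (w, v) = t].
  apply: measurable_eqr_set; last exact: measurable_cst.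
  apply: (measurableT_comp measurable_next_time).
  exact: pair1_measurable.
have m01 : measurable (~` `]0, 1[ : set R) by apply: measurableC.
have out0 : pr unif (~` `]0, 1[) = 0.
  apply: pr_uniform_lt => //= v v0 v1.
  by rewrite in_itv/= v0 v1 ltNge (ltW v0); split => //; case.
apply/eqP; rewrite eq_le pr_ge0 andbT.
apply: (@le_trans _ _ (pr unif (~` `]0, 1[ `|` [set c]))).
  apply: le_pr => //; first by apply: measurableU => //; exact: measurable_set1.
  move=> v /= vt; have [v01|v01] := boolP (0 < v < 1); last first.
    by left; apply/negP; rewrite in_itv.
  right; have [_ /(_ v01) + _] := tau'P (w, v).
  by rewrite vt /c /= => ->; rewrite mulfK// gt_eqF.
apply: (@le_trans _ _ (pr unif (~` `]0, 1[) + pr unif [set c])); last first.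
  by rewrite out0 pr_uniform1 addr0.
rewrite -lee_fin EFinD !prK//.
- exact: measureU2.
- by apply: measurableU.
Qed.

(** For [A] contained in [tau <= u], this times [G u] is the probability that [A] holds and the next
    arrival comes after [u]. *)
Definition inv_survival (A : set T) : R :=
  fine (\int[P]_(w in A) ((G (tau w))^-1)%:E)%E.

Definition time_integral (A : set T) (u : R) : R :=
  fine (\int[mu]_(v in `[0%R, u]) (pr P (A `&` [set w | (tau w <= v)%R]) * q v)%:E)%E.

Let m_invG (A : set T) : measurable_fun A (fun w => ((G (tau w))^-1)%:E).
Proof.
apply/measurable_EFinP/measurable_funTS.
have mVG : measurable_fun setT (fun x => (G x)^-1).
  apply: continuous_measurable_fun => x.
  by apply: continuousV; [rewrite gt_eqF|exact: (hazard_continuous hz)].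
exact: (measurableT_comp mVG mtau).
Qed.

Let invG_ge0 w : (0 <= ((G (tau w))^-1)%:E)%E.
Proof. by rewrite lee_fin invr_ge0 ltW. Qed.

(** With [w] fixed in [A], the next arrival is later than [u] exactly when [v < G u / G (tau w)],
    and [v] is uniform. *)
Lemma survivalE (A : set T) u : measurable A -> A `<=` [set w | tau w <= u] ->
  (P' [set x | A x.1 /\ (u < tau' x)%R] =
   (G u)%:E * \int[P]_(w in A) ((G (tau w))^-1)%:E)%E.
Proof.
move=> mA Au.
rewrite -ge0_integralZl//; try (by rewrite lee_fin ltW); try exact: m_invG.
rewrite [RHS]integral_mkcond; apply: eq_integral => w _ /=.
rewrite patchE; case: ifPn => [|]; rewrite ?inE ?notin_setE => Aw.
  have tu : tau w <= u by exact: Au.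
  have u0 : 0 <= u by exact: le_trans (tau_ge0 w) tu.
  rewrite -EFinM; apply: uniform_prob_lt.
  - apply: measurable_xsection.
    rewrite (_ : [set _ | _] = [set x : T * R | A x.1] `&` [set x | u < tau' x]).
      apply: measurableI; first exact: measurable_setX_fst.
      apply: measurable_ltr_set; first exact: measurable_cst.
      exact: measurable_next_time.
    by apply/seteqP; split.
  - by rewrite divr_ge0// ltW.
  - by rewrite ler_pdivrMr// mul1r hazard_le.
  - move=> v v0 v1; rewrite /xsection/= inE/= ltNge tau'E/= v0 v1 tu/= -ltNge.
    by rewrite ltr_pdivlMr//; split => [[]|].
rewrite (_ : xsection _ _ = set0) ?measure0//.
by apply/seteqP; split => // v; rewrite /xsection/= inE => -[].
Qed.

(** Tonelli's theorem for [q v] on the region [w] in [A], [tau w <= v <= u], where the integral over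
    [v] is [(G u)^-1 - (G (tau w))^-1]. The integral of [(G tau)^-1] is thus expressed by the
    distribution function of [tau] on [A]. *)
Lemma time_integralE (A : set T) u : 0 <= u -> measurable A ->
  A `<=` [set w | tau w <= u] ->
  (\int[P]_(w in A) ((G (tau w))^-1)%:E +
   \int[mu]_(v in `[0%R, u]) (pr P (A `&` [set w | (tau w <= v)%R]) * q v)%:E =
   (pr P A / G u)%:E)%E.
Proof.
move=> u0 mA Au.
pose B := [set x : T * R | A x.1 /\ (0 <= x.2 <= u) /\ tau x.1 <= x.2].
pose f (x : T * R) := (\1_B x * q x.2)%:E.
have mB : measurable B.
  rewrite (_ : B = [set x | A x.1] `&`
    ([set x | x.2 \in `[0, u]] `&` [set x | tau x.1 <= x.2])).
    apply: measurableI; first exact: measurable_setX_fst.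
    apply: measurableI.
      exact: (@measurable_setX_snd _ _ T R [set` `[0, u]]).
    apply: measurable_ler_set; last exact: measurable_snd.
    by apply: measurableT_comp => //; exact: measurable_fst.
  by apply/seteqP; split => x; rewrite /B/= in_itv.
have mq : measurable_fun setT q.
  exact: continuous_measurable_fun (hazard_density_continuous hz).
have q0 := hazard_density_ge0 hz.
have mf : measurable_fun setT f.
  apply/measurable_EFinP; apply: measurable_funM.
    exact: measurable_indic.
  by apply: (measurableT_comp mq); exact: measurable_snd.
have f0 x : (0 <= f x)%E by rewrite lee_fin mulr_ge0.
have swap := fubini_tonelli (m1 := P) (m2 := mu) f mf f0.
have lhs w : (\int[mu]_v f (w, v) =
    ((fun w => ((G u)^-1 - (G (tau w))^-1)%:E) \_ A) w)%E.
  rewrite patchE; case: ifPn => [|]; rewrite ?inE ?notin_setE => Aw; last first.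
    rewrite integral0_eq// => v _; rewrite /f indicE memNset ?mul0r//.
    by move=> [].
  have tu : tau w <= u by exact: Au.
  rewrite -(hazard_integral hz (tau_ge0 w) tu) [RHS]integral_mkcond.
  apply: eq_integral => v _; rewrite patchE /f indicE.
  case: ifPn => [|]; rewrite ?inE ?notin_setE/= in_itv/=.
    move=> /andP[tv vu]; rewrite mem_set ?mul1r//; split => //; split => //=.
    by rewrite vu (le_trans (tau_ge0 w) tv).
  move=> nv; rewrite memNset ?mul0r// => -[_ [/andP[_ vu] tv]].
  by apply: nv; rewrite /= in tv vu; rewrite tv vu.
have rhs v : (\int[P]_w f (w, v) =
    ((fun v => (pr P (A `&` [set w | (tau w <= v)%R]) * q v)%:E) \_ `[0%R, u]) v)%E.
  rewrite patchE; case: ifPn => [|]; rewrite ?inE ?notin_setE/= in_itv/= => vu.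
    have mAv : measurable (A `&` [set w | tau w <= v]).
      apply: measurableI => //; apply: measurable_ler_set => //.
    rewrite (eq_integral (fun w => (q v)%:E * (\1_(A `&` [set w | tau w <= v]) w)%:E)%E).
      rewrite ge0_integralZl//; last 2 first.
      - by apply/measurable_EFinP; exact: measurable_indic.
      - by rewrite lee_fin.
      by rewrite integral_indic// setIT EFinM prK// muleC.
    move=> w _; rewrite /f -EFinM mulrC; congr (_ * _)%:E.
    rewrite !indicE; congr (_%:R); congr nat_of_bool; apply/idP/idP; rewrite !inE.
      by move=> [Aw [_ tv]].
    by move=> [Aw tv]; split => //=.
  rewrite integral0_eq// => w _; rewrite /f indicE memNset ?mul0r//.
  by move=> [_ [/= vu' _]].
have <- : (\int[P]_(w in A) ((G u)^-1 - (G (tau w))^-1)%:E =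
    \int[mu]_(v in `[0%R, u]) (pr P (A `&` [set w | (tau w <= v)%R]) * q v)%:E)%E.
  rewrite [LHS]integral_mkcond [RHS]integral_mkcond.
  transitivity (\int[P]_w \int[mu]_v f (w, v))%E.
    by apply: eq_integral => w _; rewrite lhs.
  by rewrite swap; apply: eq_integral => v _; exact: rhs.
(* The two integrands over [A] add up to the constant [(G u)^-1]. *)
rewrite -ge0_integralD//=.
- under eq_integral do rewrite -EFinD addrC subrK.
  by rewrite integral_cst// mulrC EFinM prK.
- move=> w Aw; rewrite lee_fin subr_ge0 lef_pV2 ?posrE//.
  by rewrite hazard_le//; exact: Au.
- apply/measurable_EFinP; apply: measurable_funB; first exact: measurable_cst.
  by apply/measurable_EFinP; exact: m_invG.
Qed.

Lemma time_integral_fin_num (A : set T) u : 0 <= u -> measurable A ->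
  A `<=` [set w | tau w <= u] ->
  ((\int[P]_(w in A) ((G (tau w))^-1)%:E) \is a fin_num /\
   (\int[mu]_(v in `[0%R, u])
     (pr P (A `&` [set w | (tau w <= v)%R]) * q v)%:E) \is a fin_num)%E.
Proof.
move=> u0 mA Au; have E := time_integralE u0 mA Au.
have a0 : (0 <= \int[P]_(w in A) ((G (tau w))^-1)%:E)%E by exact: integral_ge0.
have b0 : (0 <= \int[mu]_(v in `[0%R, u])
    (pr P (A `&` [set w | (tau w <= v)%R]) * q v)%:E)%E.
  apply: integral_ge0 => v _.
  by rewrite lee_fin mulr_ge0 ?pr_ge0// (hazard_density_ge0 hz).
split; rewrite ge0_fin_numE// (le_lt_trans _ (ltry (pr P A / G u)))// -E.
  by rewrite leeDl.
by rewrite leeDr.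
Qed.

Lemma survival_inv (A : set T) u : 0 <= u -> measurable A ->
  A `<=` [set w | tau w <= u] ->
  pr P' [set x | A x.1 /\ u < tau' x] = G u * inv_survival A /\
  inv_survival A + time_integral A u = pr P A / G u.
Proof.
move=> u0 mA Au; have [a_fin b_fin] := time_integral_fin_num u0 mA Au.
split; last by rewrite -fineD// time_integralE.
rewrite -[G u]/(fine (G u)%:E) -fineM//; congr fine; exact: survivalE.
Qed.

(** Lack of memory: both sides equal [G t * G u * inv_survival A]. *)
Lemma survival_time (A : set T) t u : 0 <= t -> t <= u -> measurable A ->
  A `<=` [set w | tau w <= t] ->
  pr P' [set x | A x.1 /\ u < tau' x] * G t =
  pr P' [set x | A x.1 /\ t < tau' x] * G u.
Proof.
move=> t0 tu mA At.
have Au : A `<=` [set w | tau w <= u] by move=> w /At/= /le_trans; apply.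
have [-> _] := survival_inv (le_trans t0 tu) mA Au.
by have [-> _] := survival_inv t0 mA At; ring.
Qed.

Lemma time_integralZ (A : set T) u (c : R) : 0 <= u -> measurable A -> 0 <= c ->
  (\int[mu]_(v in `[0%R, u])
    (pr P (A `&` [set w | (tau w <= v)%R]) * q v * c)%:E =
  (\int[mu]_(v in `[0%R, u])
    (pr P (A `&` [set w | (tau w <= v)%R]) * q v)%:E) * c%:E)%E.
Proof.
move=> u0 mA c0; rewrite -ge0_integralZr//.
- apply/measurable_EFinP/measurable_funTS; apply: measurable_funM.
    apply: nondecreasing_measurable => // x y xy.
    apply: le_pr.
    + by apply: measurableI => //; exact: measurable_ler_set.
    + by apply: measurableI => //; exact: measurable_ler_set.
    + by move=> w [Aw /= tx]; split => //=; exact: le_trans xy.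
  exact: continuous_measurable_fun (hazard_density_continuous hz).
- by move=> v _; rewrite lee_fin mulr_ge0 ?pr_ge0// (hazard_density_ge0 hz).
Qed.

(** By [survival_inv], survival depends on an event only through the distribution function of [tau]
    on it, and linearly. Proportionality, the form in which the Markov property is stated, is
    therefore passed on to the next arrival. *)
Lemma survival_prop (A B : set T) u (a b : R) : 0 <= u ->
  measurable A -> measurable B ->
  A `<=` [set w | tau w <= u] -> B `<=` [set w | tau w <= u] ->
  0 <= a -> 0 <= b ->
  (forall v, 0 <= v -> v <= u ->
    pr P (A `&` [set w | tau w <= v]) * b =
    pr P (B `&` [set w | tau w <= v]) * a) ->
  pr P' [set x | A x.1 /\ u < tau' x] * b =
  pr P' [set x | B x.1 /\ u < tau' x] * a.
Proof.
move=> u0 mA mB Au Bu a0 b0 prop.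
have [-> EA] := survival_inv u0 mA Au.
have [-> EB] := survival_inv u0 mB Bu.
have prAB : pr P A * b = pr P B * a.
  by have := prop u u0 (lexx u); rewrite !setIidl.
have intAB : time_integral A u * b = time_integral B u * a.
  rewrite /time_integral.
  have := time_integralZ u0 mA b0; have := time_integralZ u0 mB a0.
  set I := (\int[mu]_(_ in _) (_ * _ * a)%:E)%E => EI EJ.
  have IJ : (\int[mu]_(v in `[0%R, u])
      (pr P (A `&` [set w | (tau w <= v)%R]) * q v * b)%:E = I)%E.
    apply: eq_integral => v; rewrite inE/= in_itv/= => /andP[v0 vu].
    by congr _%:E; rewrite mulrAC prop// mulrAC.
  have [_ finA] := time_integral_fin_num u0 mA Au.
  have [_ finB] := time_integral_fin_num u0 mB Bu.
  by rewrite -[b]/(fine b%:E) -[a]/(fine a%:E) -!fineM// -EI -EJ IJ.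
have EA' : inv_survival A = pr P A / G u - time_integral A u by rewrite -EA addrK.
have EB' : inv_survival B = pr P B / G u - time_integral B u by rewrite -EB addrK.
rewrite -!mulrA; congr (_ * _); rewrite EA' EB' !mulrBl intAB.
by rewrite mulrAC prAB mulrAC.
Qed.

(** The event [tau <= u] splits according to whether the next arrival has occurred by [u]; by
    [hazard_tail] the part where it has not has probability [F0 u - F1 u]. *)
Lemma next_time_cdf : (forall v, 0 <= v -> pr P [set w | tau w <= v] = F0 v) ->
  forall u, 0 <= u -> pr P' [set x | tau' x <= u] = F1 u.
Proof.
move=> cdf u u0.
pose A := [set w | tau w <= u].
have mA : measurable A by exact: measurable_ler_set.
have [E1 E2] := @survival_inv A u u0 mA (@subset_refl _ A).
have E3 : time_integral A u = F1 u / G u.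
  rewrite /time_integral -[RHS]/(fine (F1 u / G u)%:E) -(hazard_tail hz u0).
  congr fine; apply: eq_integral => v; rewrite inE/= in_itv/= => /andP[v0 vu].
  rewrite -cdf// setIidr// => w /=; rewrite /A/= => tv; exact: le_trans vu.
have E4 : pr P A = F0 u by exact: cdf.
have mt' : measurable [set x | tau' x <= u].
  apply: measurable_ler_set; first exact: measurable_next_time.
  exact: measurable_cst.
have mS : measurable [set x : T * R | A x.1 /\ u < tau' x].
  rewrite (_ : [set _ | _] = [set x : T * R | A x.1] `&` [set x | u < tau' x]).
    apply: measurableI; first exact: measurable_setX_fst.
    apply: measurable_ltr_set; first exact: measurable_cst.
    exact: measurable_next_time.
  by apply/seteqP; split.
have E5 : pr P A = pr P' [set x | A x.1 /\ u < tau' x] +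
    pr P' [set x | tau' x <= u].
  have disj : [set x : T * R | A x.1 /\ u < tau' x] `&` [set x | tau' x <= u]
      = set0.
    by apply/seteqP; split => // x [[_ /= ux] /=]; rewrite leNgt ux.
  rewrite -(prU P' mS mt' disj); apply: etrans (esym (pr_prod_fst P unif mA)) _.
  congr pr; apply/seteqP; split => x; rewrite /A/=.
    by move=> tu; have [xu|ux] := leP (tau' x) u; [right|left].
  by move=> [[]|/(lt_le_trans (tau_lt x))/ltW].
move: E5; rewrite E1 E4.
have -> : inv_survival A = F0 u / G u - F1 u / G u by rewrite -E4 -E2 E3 addrK.
have Gu : G u != 0 by rewrite gt_eqF.
rewrite mulrBr !(mulrC (G u)) (divfK Gu) (divfK Gu) => E.
by apply: (addrI (F0 u - F1 u)); rewrite -E subrK.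
Qed.

End NextTime.

(** * The birth chain of one coordinate *)

Section Definitions.
Context (R : realType) (T : Type).

Fixpoint path_event (X : R -> T -> nat) (ts : seq R) (b : nat -> nat) : set T :=
  if ts is t :: ts' then
    [set w | X t w = b 0%N] `&` path_event X ts' (fun i => b i.+1)
  else setT.

(* [tau k] is the time of arrival at level [k]. *)
Definition level (tau : nat -> T -> R) (m : nat) (t : R) (w : T) : nat :=
  (\sum_(k < m) (tau k.+1 w <= t)%R)%N.

End Definitions.

Section PathEvents.
Context (R : realType) (d : measure_display) (T : measurableType d)
  (P : probability T R).
Implicit Type X : R -> T -> nat.

Lemma path_eventE X ts b : path_event X ts b =
  [set w | forall i, (i < size ts)%N -> X (nth 0 ts i) w = b i].
Proof.
elim: ts b => [|t ts IH] b /=; first by apply/seteqP; split.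
rewrite IH; apply/seteqP; split => w /= => [[E0 E] [|i] //|E].
  exact: E.
by split => [|i]; [exact: (E 0%N)|exact: (E i.+1)].
Qed.

Lemma measurable_path_event X ts b :
  (forall t k, measurable [set w | X t w = k]) -> measurable (path_event X ts b).
Proof.
move=> mX; elim: ts b => [|t ts IH] b //=; exact: measurableI.
Qed.

(* The value to be reached at the last time comes first in [b]. *)
Definition markov_chain (X : R -> T -> nat) : Prop :=
  forall (ts : seq R) (t u : R) (b : nat -> nat),
    all (fun p => (0 <= p) && (p < t)) ts -> 0 <= t -> t < u ->
    pr P (path_event X [:: u, t & ts] b) *
    pr P (path_event X [:: t] (fun i => b i.+1)) =
    pr P (path_event X (t :: ts) (fun i => b i.+1)) *
    pr P (path_event X [:: u; t] b).

(** [j] is the top value of the target law and [m] the number of jumps built so far; the coordinate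
    is complete at [m = j]. Absence of atoms serves later to exclude simultaneous jumps of distinct
    coordinates. *)
Record jump_chain (j m : nat) (tau : nat -> T -> R) : Prop := JumpChain {
  jump_measurable : forall k, measurable_fun setT (tau k);
  jump0 : forall w, tau 0%N w = 0;
  jump_lt : forall k w, (k < m)%N -> tau k w < tau k.+1 w;
  jump_cdf : forall k t, (k <= m)%N -> 0 <= t ->
    pr P [set w | tau k w <= t] = tail j k t;
  jump_atomless : forall k x, (0 < k <= m)%N -> pr P [set w | tau k w = x] = 0;
  jump_markov : markov_chain (level tau m) }.

Section Level.
Context (tau : nat -> T -> R) (m : nat).
Hypothesis mtau : forall k, measurable_fun setT (tau k).
Hypothesis tau0 : forall w, tau 0%N w = 0.
Hypothesis tau_lt : forall k w, (k < m)%N -> tau k w < tau k.+1 w.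

Lemma jump_le k l w : (k <= l <= m)%N -> tau k w <= tau l w.
Proof.
move=> /andP[/subnK <-]; elim: (l - k)%N => // i IH ilm.
by rewrite (le_trans (IH (ltnW ilm)))// ltW// tau_lt.
Qed.

Lemma jump_ge0 k w : (k <= m)%N -> 0 <= tau k w.
Proof. by move=> km; rewrite -(tau0 w) jump_le. Qed.

Lemma level_le t w : (level tau m t w <= m)%N.
Proof.
rewrite -[leqRHS](card_ord m) -sum1_card; apply: leq_sum => k _.
exact: leq_b1.
Qed.

Lemma level_mono t u w : t <= u -> (level tau m t w <= level tau m u w)%N.
Proof.
move=> tu; apply: leq_sum => k _.
by case: (leP _ t) => // /le_trans ->.
Qed.

(** Arrival times increase, so the indicators summed in [level] form an initial block of ones. *)
Lemma level_geP t w k : (0 < k <= m)%N ->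
  (k <= level tau m t w)%N = (tau k w <= t).
Proof.
case: k => // k /= km; apply/idP/idP.
  apply: contraLR; rewrite -ltNge -ltnNge => tk.
  rewrite ltnS /level (bigID (fun i : 'I_m => (i < k)%N))/=.
  rewrite [X in (_ + X)%N]big1 ?addn0.
    apply: (@leq_trans (\sum_(i < m | (i < k)%N) 1)%N).
      by apply: leq_sum => i _; exact: leq_b1.
    by rewrite -(@big_ord_widen _ _ _ k m (fun=> 1%N) (ltnW km)) sum1_card card_ord.
  move=> i; rewrite -leqNgt => ki; rewrite leNgt (lt_le_trans tk)//.
  by rewrite jump_le// ltnS ki ltn_ord.
move=> tk; rewrite /level.
apply: (@leq_trans (\sum_(i < m | (i < k.+1)%N) 1)%N).
  by rewrite -(@big_ord_widen _ _ _ k.+1 m (fun=> 1%N))// sum1_card card_ord.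
rewrite [leqRHS](bigID (fun i : 'I_m => (i < k.+1)%N))/=.
apply: leq_trans (leq_addr _ _); apply: leq_sum => i ik.
by rewrite (le_trans _ tk)// jump_le// ik.
Qed.

Lemma level_eq_top t w : 0 <= t -> (level tau m t w == m) = (tau m w <= t).
Proof.
move=> t0; rewrite eqn_leq level_le/=.
have [m0|m0] := posnP m; last by rewrite level_geP// m0 leqnn.
by rewrite m0 tau0 t0.
Qed.

End Level.

Lemma measurable_level (tau : nat -> T -> R) m t c :
  (forall k, measurable_fun setT (tau k)) ->
  measurable [set w | level tau m t w = c].
Proof.
move=> mtau; elim: m c => [|m IH] c.
  rewrite (_ : [set _ | _] = [set w | 0%N = c]); last first.
    by apply/seteqP; split => w; rewrite /level/= big_ord0.
  have [<-|/eqP c0] := eqVneq 0%N c.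
    by rewrite (_ : [set _ | _] = setT)//; apply/seteqP; split.
  by rewrite (_ : [set _ | _] = set0)//; apply/seteqP; split.
have mt : measurable [set w | tau m.+1 w <= t].
  by apply: measurable_ler_set => //; exact: measurable_cst.
rewrite (_ : [set _ | _] =
  ([set w | tau m.+1 w <= t] `&`
    (if c is c'.+1 then [set w | level tau m t w = c'] else set0))
  `|` (~` [set w | tau m.+1 w <= t] `&` [set w | level tau m t w = c])).
  apply: measurableU; apply: measurableI => //; last exact: measurableC.
  by case: c => // c; exact: measurable0.
apply/seteqP; split => w /=; rewrite /level big_ord_recr/=.
  case: (leP (tau m.+1 w) t) => tt /= E; [left|right]; split => //.
    by case: c E => [|c] /=; rewrite addn1// => -[].
  by rewrite -E addn0.
move=> [[->]|[/negP/negbTE -> ->]]; last by rewrite addn0.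
by case: c => // c /= ->; rewrite addn1.
Qed.

End PathEvents.

Lemma cross_ratio (F : fieldType) (a a' b b' g g' : F) : g != 0 ->
  a * g = a' * g' -> b * g = b' * g' -> a * b' = a' * b.
Proof.
move=> g0 ea eb; apply: (mulIf g0).
by rewrite mulrAC ea -[RHS]mulrA eb -!mulrA (mulrC g').
Qed.

(** [pa] stands for the probability of [A], [ya] for that of [A] with the old chain at level [m] at
    time [u], and [am] for the part of the latter where the new jump is still to come; likewise for
    [B]. *)
Lemma jump_balance (F : comNzRingType) (pa pb am bm ya yb : F) :
  am * pb = bm * pa -> ya * pb = yb * pa ->
  (pa - (am + (pa - ya))) * pb = pa * (pb - (bm + (pb - yb))).
Proof.
move=> em ey.
rewrite (_ : (_ - _) * pb = ya * pb - am * pb); last by ring.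
by rewrite em ey; ring.
Qed.

(** * Markov property of an extended chain: [S C v] is the probability that [C] holds and the new
    jump is later than [v] *)

Section MarkovCore.
Context (R : realType) (d : measure_display) (T : measurableType d)
  (P : probability T R).
Context (j m : nat) (tau : nat -> T -> R) (chain : jump_chain P j m tau).
Local Notation Y := (level tau m).
Context (G : R -> R) (S : set T -> R -> R).
Hypotheses (G_gt0 : forall x, 0 < G x) (S0 : forall v, S set0 v = 0).
Hypothesis S_before : forall C v, measurable C ->
  C `<=` [set w | v < tau m w] -> S C v = pr P C.
Hypothesis S_split : forall C v D, measurable C -> measurable D ->
  S C v = S (C `&` D) v + S (C `\` D) v.
Hypothesis S_time : forall C t u, 0 <= t -> t <= u -> measurable C ->
  C `<=` [set w | tau m w <= t] -> S C u * G t = S C t * G u.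
Hypothesis S_prop : forall (A B : set T) u (a b : R), 0 <= u ->
  measurable A -> measurable B ->
  A `<=` [set w | tau m w <= u] -> B `<=` [set w | tau m w <= u] ->
  0 <= a -> 0 <= b ->
  (forall v, 0 <= v -> v <= u ->
    pr P (A `&` [set w | tau m w <= v]) * b =
    pr P (B `&` [set w | tau m w <= v]) * a) ->
  S A u * b = S B u * a.

Let mY t c : measurable [set w | Y t w = c].
Proof. by apply: measurable_level; exact: jump_measurable chain. Qed.

Lemma level_topP v w : 0 <= v -> (Y v w = m) <-> (tau m w <= v).
Proof.
move=> v0; split => [/eqP|E]; [|apply/eqP];
  by rewrite (level_eq_top (jump0 chain) (jump_lt chain)).
Qed.

Lemma level_top_stay t u w : 0 <= t -> t < u -> tau m w <= t -> Y u w = m.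
Proof.
move=> t0 tu tw; apply/level_topP; first exact: le_trans (ltW tu).
exact: le_trans (ltW tu).
Qed.

Lemma setI_level_top C t u : 0 <= t -> t < u -> C `<=` [set w | tau m w <= t] ->
  C `&` [set w | Y u w = m] = C.
Proof. by move=> t0 tu Ct; apply: setIidl => w /Ct; exact: level_top_stay. Qed.

Lemma setI_level_top0 C t u k : 0 <= t -> t < u -> k <> m ->
  C `<=` [set w | tau m w <= t] -> C `&` [set w | Y u w = k] = set0.
Proof.
move=> t0 tu km Ct; apply/seteqP; split => [w [Cw Yu]|w []].
by apply: km; rewrite -Yu; apply: (level_top_stay t0 tu); exact: Ct.
Qed.

(* The branches: a state of the old chain, the new state, an impossible one. *)
Definition future (C : set T) (t u : R) (k : nat) : R :=
  if (k <= m)%N then S (C `&` [set w | Y u w = k]) u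
  else if k == m.+1 then S C t - S C u else 0.

Section Events.
Context (A B : set T) (t u : R) (s : nat).
Hypotheses (t0 : 0 <= t) (tu : t < u) (mA : measurable A) (mB : measurable B).
Hypotheses (AY : forall w, A w -> Y t w = s) (BY : forall w, B w -> Y t w = s).
Hypothesis MY : forall v k, t < v ->
  pr P (A `&` [set w | Y v w = k]) * pr P B =
  pr P (B `&` [set w | Y v w = k]) * pr P A.

Let u0 : 0 <= u. Proof. exact: le_trans (ltW tu). Qed.

(** The old chain has reached its last level, so only the new jump is random, and its survival from
    [t] to [u] has the same ratio on [A] and [B]. *)
Lemma future_markov_top k : s = m -> future A t u k * S B t = S A t * future B t u k.
Proof.
move=> sm.
have At : A `<=` [set w | tau m w <= t].
  by move=> w /AY; rewrite sm => /(level_topP _ t0).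
have Bt : B `<=` [set w | tau m w <= t].
  by move=> w /BY; rewrite sm => /(level_topP _ t0).
have prop : S A u * S B t = S A t * S B u.
  have Gt : G t != 0 by rewrite gt_eqF.
  exact: (cross_ratio Gt (S_time t0 (ltW tu) mA At) (S_time t0 (ltW tu) mB Bt)).
rewrite /future; have [->|/eqP k0] := eqVneq k m.
  by rewrite leqnn (setI_level_top t0 tu At) (setI_level_top t0 tu Bt).
rewrite (setI_level_top0 t0 tu k0 At) (setI_level_top0 t0 tu k0 Bt) S0.
case: ifP => _; first by rewrite mul0r mulr0.
case: ifP => _; last by rewrite mul0r mulr0.
by rewrite mulrBl mulrBr prop.
Qed.

(** Level [m] is not reached by time [t], so [S] is the plain probability at [t]. The old Markov
    property makes the arrival times at [m] proportional on [A] and [B], and [S_prop] carries this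
    over to the new jump. *)
Lemma future_markov_below k : (s < m)%N ->
  future A t u k * S B t = S A t * future B t u k.
Proof.
move=> sm.
have before C : (forall w, C w -> Y t w = s) -> C `<=` [set w | t < tau m w].
  move=> CY w /CY Yt /=; rewrite ltNge; apply/negP => /(level_topP _ t0) Ym.
  by move: sm; rewrite -Yt Ym ltnn.
have At := before A AY; have Bt := before B BY.
have propm : S (A `&` [set w | Y u w = m]) u * pr P B =
    S (B `&` [set w | Y u w = m]) u * pr P A.
  have top C : C `&` [set w | Y u w = m] `<=` [set w | tau m w <= u].
    by move=> w [_ /(level_topP _ u0)].
  apply: (S_prop u0 (measurableI _ _ mA (mY u m)) (measurableI _ _ mB (mY u m))
    (top A) (top B) (pr_ge0 _ _) (pr_ge0 _ _)).
  (* No arrival at [m] happens up to [t]; after [t], arrival by time [v] means being at level [m] at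
     time [v], where [MY] applies. *)
  move=> v v0 vu; have [vt|tv] := leP v t.
    have E C : C `<=` [set w | t < tau m w] ->
        C `&` [set w | Y u w = m] `&` [set w | tau m w <= v] = set0.
      move=> Ct; apply/seteqP; split => [w [[/Ct/= tw _] /= wv]|w []].
      by move: (le_trans wv vt); rewrite leNgt tw.
    by rewrite (E _ At) (E _ Bt) pr0 !mul0r.
  have E C : C `&` [set w | Y u w = m] `&` [set w | tau m w <= v] =
      C `&` [set w | Y v w = m].
    apply/seteqP; split => w /= [].
      by move=> [Cw _] wv; split; [|exact/level_topP].
    move=> Cw /(level_topP _ v0) wv; split; [split; [by []|]|by []].
    by apply/level_topP; [|exact: le_trans vu].
  by rewrite !E MY.
rewrite /future (S_before mA At) (S_before mB Bt).
case: ifPn => [|_].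
  rewrite leq_eqVlt => /predU1P[->|km]; first by rewrite propm mulrC.
  have E C : measurable C -> S (C `&` [set w | Y u w = k]) u =
      pr P (C `&` [set w | Y u w = k]).
    move=> mC; apply: S_before; first exact: measurableI.
    move=> w [_ /= Yu]; rewrite ltNge; apply/negP => /(level_topP _ u0) Ym.
    by move: km; rewrite -Yu Ym ltnn.
  by rewrite (E _ mA) (E _ mB) MY// mulrC.
case: ifP => _; last by rewrite mul0r mulr0.
(* Off the event [Y u = m], level [m] is reached after [u], so the new jump is certainly still to
   come. *)
have E C : measurable C -> S C u =
    S (C `&` [set w | Y u w = m]) u + (pr P C - pr P (C `&` [set w | Y u w = m])).
  move=> mC; have mD : measurable (C `\` [set w | Y u w = m]) by exact: measurableD.
  rewrite (S_split u mC (mY u m)); congr (_ + _).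
  have Du : C `\` [set w | Y u w = m] `<=` [set w | u < tau m w].
    by move=> w [_ /= nY]; rewrite ltNge; apply/negP => /(level_topP _ u0).
  rewrite (S_before mD Du).
  have disj : C `&` [set w | Y u w = m] `&` (C `\` [set w | Y u w = m]) = set0.
    by apply/seteqP; split => // w [[_ Yw] [_ /(_ Yw)]].
  have := prU P (measurableI _ _ mC (mY u m)) mD disj.
  by rewrite setUIDK => ->; rewrite addrAC subrr add0r.
rewrite (E _ mA) (E _ mB); exact: jump_balance propm (MY m tu).
Qed.

End Events.

Lemma future_markov ts t u (b : nat -> nat) k :
  all (fun p => (0 <= p) && (p < t)) ts -> 0 <= t -> t < u -> (b 0%N <= m)%N ->
  future (path_event Y (t :: ts) b) t u k * S (path_event Y [:: t] b) t =
  S (path_event Y (t :: ts) b) t * future (path_event Y [:: t] b) t u k.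
Proof.
move=> past t0 tu bm.
pose A := path_event Y (t :: ts) b; pose B := path_event Y [:: t] b.
have mA : measurable A by exact: measurable_path_event.
have mB : measurable B by exact: measurable_path_event.
have MY v l : t < v -> pr P (A `&` [set w | Y v w = l]) * pr P B =
    pr P (B `&` [set w | Y v w = l]) * pr P A.
  move=> tv.
  have E := jump_markov chain (fun i => if i is i'.+1 then b i' else l) past t0 tv.
  by rewrite (setIC A) (setIC B) [RHS]mulrC; exact: E.
have AY w : A w -> Y t w = b 0%N by case.
have BY w : B w -> Y t w = b 0%N by case.
move: bm; rewrite leq_eqVlt => /predU1P[bm|bm].
  exact: (future_markov_top t0 tu mA mB AY BY).
exact: (future_markov_below t0 tu mA mB AY BY).
Qed.

End MarkovCore.

(** * The chain extended by one level *)

Section ChainStep.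
Context (R : realType) (d : measure_display) (T : measurableType d)
  (P : probability T R).
Context (j m : nat) (tau : nat -> T -> R) (chain : jump_chain P j m tau).
Context (G q : R -> R) (hz : hazard (@tail R j m) (tail j m.+1) G q).
Context (tau' : T * R -> R).
Hypothesis tau'P : forall x, [/\ tau m x.1 < tau' x,
  (0 < x.2 < 1 -> G (tau' x) = x.2 * G (tau m x.1)) &
  forall t, (tau' x <= t) =
    if 0 < x.2 < 1 then (tau m x.1 <= t) && (G t <= x.2 * G (tau m x.1))
    else tau m x.1 + 1 <= t].
Local Notation unif := (uniform_prob (@ltr01 R)).
Local Notation P' := (prod_pr P unif).

Definition extend_jumps (k : nat) (x : T * R) : R :=
  if k == m.+1 then tau' x else tau k x.1.

Local Notation Y := (level tau m).
Local Notation X := (level extend_jumps m.+1).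

Let mtau := jump_measurable chain.
Let tau0 := jump0 chain.
Let tau_lt := jump_lt chain.
Let tau_ge0 w : 0 <= tau m w.
Proof. exact: (jump_ge0 tau0 tau_lt). Qed.
Let tau'_gt x : tau m x.1 < tau' x. Proof. by case: (tau'P x). Qed.
Let mtau' : measurable_fun setT tau'.
Proof. exact: (measurable_next_time hz (mtau m) tau'P). Qed.

Lemma measurable_extend_jumps k : measurable_fun setT (extend_jumps k).
Proof.
rewrite /extend_jumps; case: eqP => _ //.
by apply: (measurableT_comp (mtau k)); exact: measurable_fst.
Qed.

Let mX t c : measurable [set x | X t x = c].
Proof. by apply: measurable_level; exact: measurable_extend_jumps. Qed.

Let mY t c : measurable [set w | Y t w = c].
Proof. exact: measurable_level. Qed.

Let mN t : measurable [set w | tau m w <= t].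
Proof. by apply: measurable_ler_set => //; exact: measurable_cst. Qed.

Lemma level_extend t x : X t x = (Y t x.1 + (tau' x <= t)%R)%N.
Proof.
rewrite /level big_ord_recr/= /extend_jumps eqxx; congr (_ + _)%N.
by apply: eq_bigr => k _; rewrite eqSS (ltn_eqF (ltn_ord k)).
Qed.

Lemma level_extend_small t x s : 0 <= t -> (s <= m)%N ->
  X t x = s <-> Y t x.1 = s /\ t < tau' x.
Proof.
move=> t0 sm; rewrite level_extend; have [xt|tx] := leP (tau' x) t.
  split => [|[]//] E; exfalso.
  have /eqP Ym : Y t x.1 == m.
    by rewrite (level_eq_top tau0 tau_lt)// (le_trans (ltW (tau'_gt x))).
  by move: E; rewrite Ym addn1 => E; move: sm; rewrite -E ltnn.
by rewrite addn0; split => [|[]].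
Qed.

(** If the new jump is later than [t], old and new chains agree at [t] and at all earlier times. *)
Lemma path_event_extend ts t b : all (fun p => (0 <= p) && (p < t)) ts ->
  0 <= t -> (b 0%N <= m)%N ->
  path_event X (t :: ts) b =
  [set x | path_event Y (t :: ts) b x.1 /\ t < tau' x].
Proof.
move=> past t0 bm.
have rest b' x : t < tau' x -> path_event X ts b' x <-> path_event Y ts b' x.1.
  move=> tx; elim: ts past b' => [|p ts IH] //= /andP[/andP[p0 pt] past] b'.
  have Xp : X p x = Y p x.1 by rewrite level_extend leNgt (lt_trans pt tx) addn0.
  by split => -[/= E /(IH past) ?]; split => //=; rewrite ?Xp// -Xp.
apply/seteqP; split => x /=.
  move=> [/(level_extend_small _ t0 bm)[Yt tx] /(rest _ _ tx)]; by split.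
by move=> [[Yt r] tx]; split; [exact/level_extend_small|exact/rest].
Qed.

Let S (C : set T) v := pr P' [set x | C x.1 /\ v < tau' x].

Let mS C v : measurable C -> measurable [set x : T * R | C x.1 /\ v < tau' x].
Proof.
move=> mC; rewrite (_ : [set _ | _] = [set x : T * R | C x.1] `&` [set x | v < tau' x]).
  apply: measurableI; first exact: measurable_setX_fst.
  by apply: measurable_ltr_set; first exact: measurable_cst.
by apply/seteqP; split.
Qed.

Let S0 v : S set0 v = 0.
Proof. by rewrite -[RHS](pr0 P') /S; congr pr; apply/seteqP; split => // x []. Qed.

Let S_before C v : measurable C -> C `<=` [set w | v < tau m w] -> S C v = pr P C.
Proof.
move=> mC Cv; rewrite -(pr_prod_fst P unif mC) /S; congr pr.
apply/seteqP; split => x /=; first by case.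
by move=> Cx; split => //; rewrite (lt_trans (Cv _ Cx)).
Qed.

Let S_split C v D : measurable C -> measurable D ->
  S C v = S (C `&` D) v + S (C `\` D) v.
Proof.
move=> mC mD.
have disj : [set x : T * R | (C `&` D) x.1 /\ v < tau' x] `&`
    [set x : T * R | (C `\` D) x.1 /\ v < tau' x] = set0.
  by apply/seteqP; split => // x [[[_ Dx] _] [[_ nDx] _]]; exact: nDx.
rewrite /S.
rewrite -(prU P' (mS v (measurableI _ _ mC mD)) (mS v (measurableD mC mD)) disj).
congr pr; apply/seteqP; split => x /=.
  by move=> [Cx vx]; have [Dx|nDx] := pselect (D x.1); [left|right].
by move=> [|] [[? ?] ?].
Qed.

(** Reaching [k = m.+1] means that the new jump falls between [t] and [u], a difference of two
    survival events. *)
Let pr_future C t u k : measurable C -> 0 <= t -> t < u ->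
  pr P' ([set x | X u x = k] `&` [set x | C x.1 /\ t < tau' x]) =
  future m tau S C t u k.
Proof.
move=> mC t0 tu; have u0 := le_trans t0 (ltW tu).
rewrite /future; case: ifPn => [km|/negbTE].
  congr pr; apply/seteqP; split => x /=.
    by move=> [/(level_extend_small _ u0 km)[Yu ux] [Cx tx]].
  move=> [[Cx Yu] ux]; split; first exact/level_extend_small.
  by split => //; exact: lt_trans ux.
move=> km; case: ifPn => [/eqP kE|/eqP kE]; last first.
  rewrite -[RHS](pr0 P'); congr pr; apply/seteqP; split => // x /= [Xu _].
  have := level_le extend_jumps m.+1 u x; rewrite Xu leq_eqVlt => /predU1P[//|].
  by rewrite ltnS km.
have jumped x : (X u x = k) <-> (tau' x <= u).
  rewrite kE level_extend; have [xu|ux] := leP (tau' x) u.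
    split => // _; rewrite addn1; congr _.+1.
    apply/eqP; rewrite (level_eq_top tau0 tau_lt)//.
    by rewrite (le_trans (ltW (tau'_gt x))).
  split => // E; have := level_le tau m u x.1.
  by move: E; rewrite addn0 => ->; rewrite ltnn.
apply/eqP; rewrite eq_sym subr_eq; apply/eqP.
have mXu : measurable ([set x | X u x = k] `&` [set x | C x.1 /\ t < tau' x]).
  by apply: measurableI => //; exact: mS.
have disj : [set x | X u x = k] `&` [set x | C x.1 /\ t < tau' x] `&`
    [set x | C x.1 /\ u < tau' x] = set0.
  apply/seteqP; split => // x [[Xu _] [_ /= ux]].
  by move/jumped : Xu; rewrite leNgt ux.
rewrite /S -(prU P' mXu (mS u mC) disj).
congr pr; apply/seteqP; split => x /=.
  move=> [Cx tx]; have [xu|ux] := leP (tau' x) u; last by right.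
  by left; split => //=; apply/jumped.
by move=> [[_ //]|[Cx ux]]; split => //; exact: lt_trans ux.
Qed.

Let S_time C t u : 0 <= t -> t <= u -> measurable C ->
  C `<=` [set w | tau m w <= t] -> S C u * G t = S C t * G u.
Proof. exact: (survival_time hz P (mtau m) tau_ge0 tau'P). Qed.

Let S_prop (A B : set T) u (a b : R) : 0 <= u ->
  measurable A -> measurable B ->
  A `<=` [set w | tau m w <= u] -> B `<=` [set w | tau m w <= u] ->
  0 <= a -> 0 <= b ->
  (forall v, 0 <= v -> v <= u ->
    pr P (A `&` [set w | tau m w <= v]) * b =
    pr P (B `&` [set w | tau m w <= v]) * a) ->
  S A u * b = S B u * a.
Proof.
move=> u0 mA mB Au Bu a0 b0 prop.
exact: (survival_prop hz (mtau m) tau_ge0 tau'P u0 mA mB Au Bu a0 b0 prop).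
Qed.

Lemma markov_extend : markov_chain P' X.
Proof.
move=> ts t u b past t0 tu; have u0 := le_trans t0 (ltW tu).
(* A state above [m] can only be the top level [m.+1], which is absorbing: the value at [u] either
   repeats it or is impossible. *)
have [sm|ms] := leqP (b 1%N) m; last first.
  have stay x : X t x = b 1%N -> X u x = b 1%N.
    move=> Xt; apply/eqP; rewrite eqn_leq -{2}Xt level_mono ?(ltW tu)// andbT.
    exact: leq_trans (level_le _ _ _ _) ms.
  have futureT ts' : b 0%N = b 1%N -> path_event X [:: u, t & ts'] b =
      path_event X (t :: ts') (fun i => b i.+1).
    move=> E; apply/seteqP; split => x; first by case.
    by move=> XE; split => //; rewrite /= E; apply: stay; case: XE.
  have future0 ts' : b 0%N <> b 1%N -> path_event X [:: u, t & ts'] b = set0.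
    move=> E; apply/seteqP; split => // x [/= Xu [/= /stay Xu' _]].
    by apply: E; rewrite -Xu.
  have [E|/eqP E] := eqVneq (b 0%N) (b 1%N).
    by rewrite (futureT ts E) (futureT [::] E).
  by rewrite (future0 ts E) (future0 [::] E) pr0 mul0r mulr0.
have XE ts' : all (fun p => (0 <= p) && (p < t)) ts' ->
    path_event X (t :: ts') (fun i => b i.+1) =
    [set x | path_event Y (t :: ts') (fun i => b i.+1) x.1 /\ t < tau' x].
  by move=> past'; rewrite path_event_extend.
have mE ts' : measurable (path_event Y (t :: ts') (fun i => b i.+1)).
  exact: measurable_path_event.
have futureE ts' : all (fun p => (0 <= p) && (p < t)) ts' ->
    pr P' (path_event X [:: u, t & ts'] b) =
    future m tau S (path_event Y (t :: ts') (fun i => b i.+1)) t u (b 0%N).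
  move=> past'; rewrite -(pr_future _ (mE ts') t0 tu) -(XE ts' past').
  by [].
rewrite (futureE ts past) (futureE [::] isT) (XE ts past) (XE [::] isT).
exact: (future_markov chain (hazard_gt0 hz) S0 S_before S_split S_time S_prop).
Qed.

Lemma chain_step : jump_chain P' j m.+1 extend_jumps.
Proof.
split.
- exact: measurable_extend_jumps.
- by move=> x; rewrite /extend_jumps /= tau0.
- move=> k x; rewrite ltnS /extend_jumps eqSS => km.
  rewrite (ltn_eqF (leq_ltn_trans km (ltnSn m))).
  by have [->|kNm] := eqVneq k m; [exact: tau'_gt|apply: tau_lt; rewrite ltn_neqAle kNm].
- move=> k t; rewrite leq_eqVlt => /predU1P[->|km] t0; rewrite /extend_jumps.
    rewrite eqxx.
    have cdf v : 0 <= v -> pr P [set w | tau m w <= v] = tail j m v.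
      exact: (jump_cdf chain).
    exact: (next_time_cdf hz (mtau m) tau_ge0 tau'P cdf).
  rewrite (ltn_eqF km) -(jump_cdf chain)//.
  apply: (pr_prod_fst P unif (A := [set w | tau k w <= t])).
  by apply: measurable_ler_set => //; exact: measurable_cst.
- move=> k x /andP[k0]; rewrite leq_eqVlt => /predU1P[->|km]; rewrite /extend_jumps.
    rewrite eqxx; apply: pr_prod_null => [|w].
      by apply: measurable_eqr_set => //; exact: measurable_cst.
    exact: (next_time_atomless hz (mtau m) tau'P).
  rewrite (ltn_eqF km).
  have km' : (0 < k <= m)%N by rewrite k0.
  apply: etrans (jump_atomless chain x km').
  apply: (pr_prod_fst P unif (A := [set w | tau k w = x])).
  by apply: measurable_eqr_set => //; exact: measurable_cst.
- exact: markov_extend.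
Qed.

End ChainStep.

Lemma chain_exists (R : realType) (j m : nat) : (m <= j)%N ->
  exists (d : measure_display) (T : measurableType d) (P : probability T R)
    (tau : nat -> T -> R), jump_chain P j m tau.
Proof.
elim: m => [_|m IH mj].
  (* Without jumps the chain is constant, and any probability space would do. *)
  exists _, _, (uniform_prob (@ltr01 R)), (fun _ _ => 0); split => //.
  - move=> k t; rewrite leqn0 => /eqP-> t0; rewrite tail0.
    apply: etrans (prT (uniform_prob (@ltr01 R))).
    by congr pr; apply/seteqP; split.
  - by move=> k x; rewrite leqn0; case: k.
  - move=> ts t u b past t0 tu.
    have cons (x : R) l c : path_event (level (fun=> fun=> 0 : R) 0) (x :: l) c =
        if c 0%N == 0%N then path_event (level (fun=> fun=> 0 : R) 0) l (fun i => c i.+1)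
        else set0.
      apply/seteqP; split => w; rewrite /= /level big_ord0.
        by move=> [/= <-].
      by case: eqP => // -> ?; split.
    rewrite (cons _ u (t :: ts)) (cons _ u [:: t]).
    by case: ifP => _ //; rewrite !pr0 mul0r mulr0.
have [d [T [P [tau chain]]]] := IH (ltnW mj).
have [G [q hz]] := hazard_exists R mj.
have tau_ge0 w : 0 <= tau m w by exact: (jump_ge0 (jump0 chain) (jump_lt chain)).
have [tau' tau'P] := choice (fun x : T * R =>
  next_time_exists hz x.2 (tau_ge0 x.1)).
exists _, _, (prod_pr P (uniform_prob (@ltr01 R))), (extend_jumps m tau tau').
exact: (chain_step chain hz tau'P).
Qed.

(** * Independent coordinates *)

Section Family.
Context (R : realType).

Definition coordinate (T : Type) (tau : nat -> nat -> T -> R) (j : nat) :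
  R -> T -> nat := level (tau j) j.

Record jump_family (n : nat) d (T : measurableType d) (P : probability T R)
    (tau : nat -> nat -> T -> R) : Prop := JumpFamily {
  family_chain : forall j, (j < n)%N -> jump_chain P j j (tau j);
  family_indep : forall (ts : seq R) (b : 'I_n -> nat -> nat),
    pr P [set w | forall j : 'I_n, path_event (coordinate tau j) ts (b j) w] =
    \prod_(j < n) pr P (path_event (coordinate tau j) ts (b j));
  family_distinct : forall i j k l, (i < j < n)%N -> (0 < k <= i)%N ->
    (0 < l <= j)%N -> pr P [set w | tau i k w = tau j l w] = 0 }.

(** Transport along a measure-preserving map, applied to the two projections of a product. *)
Lemma jump_chain_pull d (T : measurableType d) (P : probability T R)
  d' (T' : measurableType d') (P' : probability T' R) (f : T' -> T) j m tau :
  measurable_fun setT f ->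
  (forall A, measurable A -> pr P' (f @^-1` A) = pr P A) ->
  jump_chain P j m tau -> jump_chain P' j m (fun k x => tau k (f x)).
Proof.
move=> mf prf [mtau tau0 tlt cdf atom markov].
have mle k t : measurable [set w | tau k w <= t].
  by apply: measurable_ler_set => //; exact: measurable_cst.
have meq k t : measurable [set w | tau k w = t].
  by apply: measurable_eqr_set => //; exact: measurable_cst.
split=> //.
- by move=> k; exact: measurableT_comp.
- by move=> k x km; exact: tlt.
- by move=> k t km t0; rewrite -(cdf k t km t0) -prf.
- by move=> k x km; rewrite -(atom k x km) -prf.
- move=> ts t u b past t0 tu.
  have E l c : path_event (level (fun k x => tau k (f x)) m) l c =
      f @^-1` (path_event (level tau m) l c).
    by elim: l c => [|x l IH] c //=; rewrite IH.
  have mE l c : measurable (path_event (level tau m) l c).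
    by apply: measurable_path_event => v k; exact: measurable_level.
  rewrite !E (prf _ (mE _ _)) (prf _ (mE _ _)) (prf _ (mE _ _)) (prf _ (mE _ _)).
  exact: markov.
Qed.

Lemma measurable_all_ord d (T : measurableType d) n (E : 'I_n -> set T) :
  (forall j, measurable (E j)) -> measurable [set w | forall j, E j w].
Proof.
move=> mE; rewrite (_ : [set _ | _] = ~` (\bigcup_(j in [set: 'I_n]) ~` E j)).
  by apply: measurableC; apply: fin_bigcup_measurable => // j _; exact: measurableC.
by rewrite setC_bigcup; apply/seteqP; split => w /= H j;
  [move=> _; rewrite setCK; exact: H|have := H j I; rewrite setCK].
Qed.

Lemma family_step n d (T : measurableType d) (P : probability T R) tau
  d' (T' : measurableType d') (P' : probability T' R) sigma :
  jump_family n P tau -> jump_chain P' n n sigma ->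
  jump_family n.+1 (prod_pr P P')
    (fun j k x => if j == n then sigma k x.2 else tau j k x.1).
Proof.
move=> [chains indep distinct] chain.
set tau1 := (fun j k x => _).
have tau1_old j : (j < n)%N -> tau1 j = fun k x => tau j k x.1.
  by move=> jn; rewrite /tau1 (ltn_eqF jn).
have tau1_new : tau1 n = fun k x => sigma k x.2 by rewrite /tau1 eqxx.
have path_fst j l c : (j < n)%N ->
    path_event (coordinate tau1 j) l c = [set x | path_event (coordinate tau j) l c x.1].
  move=> jn; rewrite /coordinate tau1_old//.
  by elim: l c => [|x l IH] c /=; [apply/seteqP; split|rewrite IH].
have path_snd l c :
    path_event (coordinate tau1 n) l c = [set x | path_event (level sigma n) l c x.2].
  rewrite /coordinate tau1_new.
  by elim: l c => [|x l IH] c /=; [apply/seteqP; split|rewrite IH].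
have mpath j l c : (j < n)%N -> measurable (path_event (coordinate tau j) l c).
  move=> jn; apply: measurable_path_event => v k.
  exact: measurable_level (jump_measurable (chains j jn)).
have mpathn l c : measurable (path_event (level sigma n) l c).
  apply: measurable_path_event => v k.
  exact: measurable_level (jump_measurable chain).
split.
- move=> j; rewrite ltnS leq_eqVlt => /predU1P[->|jn].
    rewrite tau1_new; apply: jump_chain_pull chain; first exact: measurable_snd.
    by move=> A mA; exact: pr_prod_snd.
  rewrite (tau1_old j jn); apply: jump_chain_pull (chains j jn).
    exact: measurable_fst.
  by move=> A mA; exact: pr_prod_fst.
- move=> ts b; rewrite big_ord_recr/=.
  pose E := [set w | forall j : 'I_n,
    path_event (coordinate tau j) ts (b (widen_ord (leqnSn n) j)) w].
  pose F := path_event (level sigma n) ts (b ord_max).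
  have -> : [set x | forall j : 'I_n.+1, path_event (coordinate tau1 j) ts (b j) x]
      = E `*` F.
    apply/seteqP; split => x /=.
      move=> H; split => [j|].
        have : path_event (coordinate tau1 j) ts (b (widen_ord (leqnSn n) j)) x.
          exact: (H (widen_ord (leqnSn n) j)).
        by rewrite path_fst.
      have : path_event (coordinate tau1 n) ts (b ord_max) x by exact: (H ord_max).
      by rewrite path_snd; apply.
    move=> [Ex Fx] j; have := ltn_ord j; rewrite ltnS leq_eqVlt => /predU1P[jn|jn].
      have -> : j = ord_max by exact: val_inj.
      suff : path_event (coordinate tau1 n) ts (b ord_max) x by [].
      by rewrite path_snd; exact: Fx.
    rewrite path_fst//; have := Ex (Ordinal jn).
    by rewrite (_ : widen_ord _ _ = j)//; exact: val_inj.
  have mE : measurable E by apply: measurable_all_ord => j; exact: mpath.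
  rewrite (pr_prod P P' mE (mpathn _ _)) indep.
  congr (_ * _).
    apply: eq_bigr => j _; rewrite (path_fst _ _ _ (ltn_ord j)).
    apply/esym/(pr_prod_fst P P').
    exact: mpath.
  by rewrite path_snd; apply/esym/(pr_prod_snd P P').
- move=> i j k l /andP[ij]; rewrite ltnS leq_eqVlt => /predU1P[jn|jn] ki lj.
    rewrite jn in ij lj *; rewrite tau1_new (tau1_old i ij).
    apply: pr_prod_null => [|w].
      apply: measurable_eqr_set.
        apply: (measurableT_comp (jump_measurable (chains i ij) k)).
        exact: measurable_fst.
      apply: (measurableT_comp (jump_measurable chain l)); exact: measurable_snd.
    (* With the old coordinates fixed, their jump time is a constant, which the new jump time almost
       surely avoids. *)
    apply: etrans (jump_atomless chain (tau i k w) lj).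
    by congr pr; apply/seteqP; split => v /= ->.
  have iN := ltn_trans ij jn.
  rewrite (tau1_old i iN) (tau1_old j jn).
  have ijn : (i < j < n)%N by rewrite ij.
  apply: etrans (distinct i j k l ijn ki lj).
  apply: (pr_prod_fst P P' (A := [set w | tau i k w = tau j l w])).
  by apply: measurable_eqr_set;
    [exact: (jump_measurable (chains i iN))|exact: (jump_measurable (chains j jn))].
Qed.

Lemma family_exists n : exists d (T : measurableType d) (P : probability T R)
  (tau : nat -> nat -> T -> R), jump_family n P tau.
Proof.
elim: n => [|n [d [T [P [tau fam]]]]].
  exists _, _, (uniform_prob (@ltr01 R)), (fun _ _ _ => 0); split => //.
  - move=> ts b; rewrite big_ord0; apply: etrans (prT (uniform_prob (@ltr01 R))).
    by congr pr; apply/seteqP; split => // w _ [].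
  - by move=> i j k l /andP[].
have [d' [T' [P' [sigma chain]]]] := @chain_exists R n n (leqnn n).
exists _, _, (prod_pr P P'), (fun j k x => if j == n then sigma k x.2 else tau j k x.1).
exact: family_step.
Qed.

End Family.

(** * From inversion tables to the process on permutations *)

Section Existence.
Context (R : realType) (n : nat) (d : measure_display) (T : measurableType d)
  (P : probability T R) (tau : nat -> nat -> T -> R).
Hypothesis fam : jump_family n P tau.
Local Notation X := (coordinate tau).

Definition perm_process (t : R) (w : T) : 'S_n :=
  sval (cid (inv_j_surj (fun j : 'I_n => level_le (tau j) j t w))).

Lemma inv_j_perm_process t w (j : 'I_n) : inv_j (perm_process t w) j = X j t w.
Proof. by rewrite /perm_process; case: cid => s /= ->. Qed.

Local Notation M := perm_process.

Lemma perm_processP t w s : M t w = s <-> forall j : 'I_n, X j t w = inv_j s j.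
Proof.
split=> [<- j|E]; first by rewrite inv_j_perm_process.
by apply: inv_j_inj => j; rewrite inv_j_perm_process.
Qed.

Let mX (j : 'I_n) t c : measurable [set w | X j t w = c].
Proof. exact: measurable_level (jump_measurable (family_chain fam (ltn_ord j))). Qed.

Lemma perm_process_is_process : is_process M.
Proof.
move=> t s; rewrite (_ : [set _ | _] = [set w | forall j : 'I_n, X j t w = inv_j s j]).
  exact: (measurable_all_ord (fun j => mX j t (inv_j s j))).
by apply/seteqP; split => w /perm_processP.
Qed.

Lemma pr_coordinate (j : 'I_n) t c : 0 <= t -> (c <= j)%N ->
  pr P [set w | X j t w = c] = t ^+ c / (geo R j.+1).[t].
Proof.
move=> t0 cj; have chain := family_chain fam (ltn_ord j).
have mN k : measurable [set w | tau j k w <= t].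
  apply: measurable_ler_set; last exact: measurable_cst.
  exact: (jump_measurable chain).
have geP w k : (k <= j)%N -> (k <= X j t w)%N = (tau j k w <= t).
  case: k => [_|k kj]; first by rewrite (jump0 chain) t0.
  by apply: (level_geP (jump_lt chain)); rewrite kj.
have Xj w : (X j t w <= j)%N by exact: level_le.
rewrite -tailB -(jump_cdf chain cj t0).
(* At the top value no further jump exists and the next tail is [0]; below it, the event is a
   difference of two arrival events. *)
move: cj; rewrite leq_eqVlt => /predU1P[cj|cj].
  have -> : tail j c.+1 t = 0 by rewrite cj tail_last.
  rewrite subr0; congr pr; apply/seteqP; split => w /=.
    by rewrite -geP ?cj// => ->.
  rewrite cj -geP// => jX; apply/eqP; by rewrite eqn_leq Xj.
rewrite -(jump_cdf chain cj t0); apply/eqP; rewrite eq_sym subr_eq; apply/eqP.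
rewrite -(prU P (mX j t c) (mN c.+1)).
  congr pr; apply/seteqP; split => w /=.
    rewrite -geP ?(ltnW cj)// leq_eqVlt => /predU1P[->|cX]; first by left.
    by right; rewrite -geP.
  by rewrite -!geP ?(ltnW cj)// => -[->|/ltnW].
apply/seteqP; split => // w [/= Xc].
by rewrite /= -geP// Xc ltnn.
Qed.

(** By independence the law is a product of truncated geometric laws, whose normalizing constants
    multiply to [mallowsZ]. *)
Lemma perm_process_marginals : mallows_marginals P M.
Proof.
move=> t t0 s.
transitivity (pr P [set w | forall j : 'I_n,
    path_event (X j) [:: t] (fun=> inv_j s j) w]).
  congr pr; apply/seteqP; split => w.
    by move=> /perm_processP E j; split => //; exact: E.
  by move=> E; apply/perm_processP => j; have [] := E j.
rewrite (family_indep fam [:: t] (fun j _ => inv_j s j)) /mallows.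
rewrite /Defs.inv -prodrXr /mallowsZ -prodf_div; apply: eq_bigr => j _.
by rewrite /= setIT pr_coordinate ?inv_j_le// geoE.
Qed.

Lemma cyl_perm_process ts : cyl M ts = [set w | forall j : 'I_n,
  path_event (X j) (map fst ts) (fun i => inv_j (nth (0, 1%g) ts i).2 j) w].
Proof.
elim: ts => [|[t s] ts IH]; first by apply/seteqP; split.
have -> : cyl M ((t, s) :: ts) = [set w | M t w = s] `&` cyl M ts.
  apply/seteqP; split => w; rewrite /cyl/=; first by move=> /andP[/eqP].
  by move=> [-> ->]; rewrite eqxx.
rewrite IH; apply/seteqP; split => w.
  by move=> [/perm_processP E E'] j; split; [exact: E|exact: E'].
by move=> E; split; [apply/perm_processP => j|move=> j]; have [] := E j.
Qed.

(** Every cylinder probability is a product over the coordinates, so the identity is the product of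
    those of the coordinate chains. *)
Lemma perm_process_markov : markov_property P M.
Proof.
move=> ts t u s x past t0 tu; rewrite !cyl_perm_process.
rewrite (family_indep fam (map fst [:: (u, x), (t, s) & ts])).
rewrite (family_indep fam (map fst [:: (t, s)])).
rewrite (family_indep fam (map fst [:: (t, s) & ts])).
rewrite (family_indep fam (map fst [:: (u, x); (t, s)])).
rewrite -!big_split; apply: eq_bigr => j _.
have past' : all (fun p => (0 <= p) && (p < t)) (map fst ts) by rewrite all_map.
exact: (jump_markov (family_chain fam (ltn_ord j))
  (fun i => inv_j (nth (0, 1%g) [:: (u, x), (t, s) & ts] i).2 j) past' t0 tu).
Qed.

Lemma perm_process_indep : independent_inversions P M.
Proof.
move=> ts a _.
rewrite (_ : [set w | _] = [set w | forall j : 'I_n, path_event (X j) ts (a j) w]).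
  rewrite family_indep//; apply: eq_bigr => j _; congr pr.
  rewrite path_eventE; apply/seteqP; split => w /= E i its.
    by rewrite inv_j_perm_process; exact: E.
  by rewrite -inv_j_perm_process; exact: E.
apply/seteqP; split => w /= E j.
  by rewrite path_eventE => i its; rewrite -inv_j_perm_process; exact: E.
move=> i its; rewrite inv_j_perm_process.
by have := E j; rewrite path_eventE; exact.
Qed.

(** Finitely many jump times leave a punctured neighbourhood of [t] free of jumps. *)
Lemma small_gap (I : finType) (c : I -> R) (t : R) : exists2 e : R, 0 < e &
  forall i, (t < c i -> t + e <= c i) /\ (c i < t -> c i <= t - e).
Proof.
have near_gap : \forall e \near 0^'+, forall i : I,
    (t < c i -> t + e <= c i) /\ (c i < t -> c i <= t - e).
  apply: filter_forall => i.
  have [ct|tc|ct] := ltgtP (c i) t.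
  - have : 0 < t - c i by rewrite subr_gt0.
    move=> /nbhs_right_lt; apply: filterS => e et; split => // _; lra.
  - have : 0 < c i - t by rewrite subr_gt0.
    move=> /nbhs_right_lt; apply: filterS => e et; split => // _; lra.
  - by apply: nearW => e; split.
have [e [e0 gap]] := filter_ex (filterI (nbhs_right_gt (0 : R)) near_gap).
by exists e.
Qed.

Let gap w t := small_gap (fun p : 'I_n * 'I_n => tau p.1 p.2.+1 w) t.

Let jump_idx (j : 'I_n) (k : 'I_j) : 'I_n := widen_ord (ltnW (ltn_ord j)) k.

Lemma perm_process_right w t : exists2 e : R, 0 < e &
  forall s, t <= s -> s < t + e -> M s w = M t w.
Proof.
have [e e0 gapP] := gap w t; exists e => // s ts se.
apply/perm_processP => j; rewrite inv_j_perm_process; apply: eq_bigr => k _.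
have [right _] := gapP (j, jump_idx k); rewrite /= in right.
have [ct|tc] := leP (tau j k.+1 w) t; first by rewrite (le_trans ct ts).
by rewrite leNgt (lt_le_trans se (right tc)).
Qed.

Lemma coordinate_left w t : exists2 e : R, 0 < e &
  forall s, t - e < s -> s < t -> forall j : 'I_n,
    X j s w = (\sum_(k < j) (tau j k.+1 w < t)%R)%N.
Proof.
have [e e0 gapP] := gap w t; exists e => // s es st j; apply: eq_bigr => k _.
have [_ left] := gapP (j, jump_idx k); rewrite /= in left.
have [ct|tc] := ltP (tau j k.+1 w) t; first by rewrite (le_trans (left ct))// ltW.
by rewrite leNgt (lt_le_trans st).
Qed.

Lemma perm_process_cadlag w : cadlag (M^~ w).
Proof.
split=> t t0; first exact: perm_process_right.
have [e e0 left] := coordinate_left w t.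
exists e => //; exists (M (t - e / 2) w) => s es st.
apply/perm_processP => j; rewrite inv_j_perm_process !left//; lra.
Qed.

(** The increase of [inv] at [t] is the number of jump times equal to [t]. Two such times cannot
    belong to one coordinate, whose jump times increase strictly, nor to two, by assumption. *)
Lemma perm_process_smooth w : (forall i j k l, (i < j < n)%N ->
    (0 < k <= i)%N -> (0 < l <= j)%N -> tau i k w <> tau j l w) ->
  smooth (M^~ w).
Proof.
move=> distinct; split.
  move=> t t' t0 tt' j; rewrite !inv_j_perm_process.
  exact: level_mono (ltW tt').
move=> t t0 sg [e e0 sgP].
have [e' e'0 left] := coordinate_left w t.
have [me me'] : Num.min e e' <= e /\ Num.min e e' <= e'.
  by rewrite !ge_min !lexx orbT.
have m0 : 0 < Num.min e e' by rewrite lt_min e0.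
pose r := Num.min e e' / 2.
have [r0 re re'] : [/\ 0 < r, r < e & r < e'] by rewrite /r; split; lra.
have <- : M (t - r) w = sg by apply: sgP; lra.
have leftE (j : 'I_n) : inv_j (M (t - r) w) j = (\sum_(k < j) (tau j k.+1 w < t)%R)%N.
  by rewrite inv_j_perm_process left//; lra.
rewrite /Defs.inv.
under eq_bigr => j _ do rewrite inv_j_perm_process.
under [in leqRHS]eq_bigr => j _ do rewrite leftE.
(* The first sum is the left limit found in [leftE]; the second counts the jumps exactly at [t]. *)
have split_eq (j : 'I_n) : X j t w =
    (\sum_(k < j) (tau j k.+1 w < t)%R + \sum_(k < j) (tau j k.+1 w == t))%N.
  rewrite -big_split; apply: eq_bigr => k _ /=.
  by rewrite le_eqVlt; case: ltgtP.
under eq_bigr => j _ do rewrite split_eq.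
rewrite big_split/= -addn1 leq_add2l.
have [[[j k] /= jk]|none] := pselect (exists p : {j : 'I_n & 'I_j},
    tau (tag p) (tagged p).+1 w = t); last first.
  rewrite big1// => j _; rewrite big1// => k _.
  by case: eqP => // jk; case: none; exists (Tagged (fun j : 'I_n => 'I_j) k).
rewrite (bigD1 j)//= (bigD1 k)//= jk eqxx.
rewrite [X in (_ + X + _)%N]big1 ?addn0; last first.
  move=> l lk; case: eqP => // jl; case/negP: lk; apply/eqP/val_inj.
  have chain := family_chain fam (ltn_ord j).
  have mono a b : (a < b)%N -> (b < j)%N -> tau j a.+1 w < tau j b.+1 w.
    move=> ab bj; apply: lt_le_trans (jump_lt chain w (leq_ltn_trans ab bj)) _.
    by apply: (jump_le (jump_lt chain)); rewrite ltnS ab.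
  case: (ltngtP l k) => // lk.
    by have := mono _ _ lk (ltn_ord k); rewrite jl jk ltxx.
  by have := mono _ _ lk (ltn_ord l); rewrite jl jk ltxx.
rewrite big1// => i ij; rewrite big1// => l _; case: eqP => // il; exfalso.
have [ij'|ji'|/val_inj E] := ltngtP i j; last by rewrite E eqxx in ij.
  apply: (distinct i j l.+1 k.+1); rewrite ?ij' ?ltn_ord//.
  by rewrite il jk.
apply: (distinct j i k.+1 l.+1); rewrite ?ji' ?ltn_ord//.
by rewrite il jk.
Qed.

Lemma ae_smooth : {ae P, forall w, smooth (M^~ w)}.
Proof.
have : {ae P, forall w, forall i j k l, (i < j < n)%N ->
    (0 < k <= i)%N -> (0 < l <= j)%N -> tau i k w <> tau j l w}.
  apply: ae_foralln => i; apply: ae_foralln => j; apply: ae_foralln => k.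
  apply: ae_foralln => l.
  have [ijn|ijn] := boolP (i < j < n)%N; last by apply: aeW => w.
  have [ki|ki] := boolP (0 < k <= i)%N; last by apply: aeW => w.
  have [lj|lj] := boolP (0 < l <= j)%N; last by apply: aeW => w.
  have [ij jn] := andP ijn; have iN := ltn_trans ij jn.
  have mE : measurable [set w | tau i k w = tau j l w].
    by apply: measurable_eqr_set;
      [exact: (jump_measurable (family_chain fam iN))
      |exact: (jump_measurable (family_chain fam jn))].
  exists [set w | tau i k w = tau j l w]; split => //.
    apply/eqP; rewrite -fine_eq0 ?fin_num_measure//; apply/eqP.
    exact: (family_distinct fam ijn ki lj).
  by move=> w /= nd; apply: contrapT => neq; apply: nd.
by apply: filterS => w; exact: perm_process_smooth.
Qed.

Lemma perm_process_regular : cadlag_markov_process P M /\ regular_mallows P M.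
Proof.
have cad : {ae P, forall w, cadlag (M^~ w)}.
  by apply: aeW => w; exact: perm_process_cadlag.
split.
  split; first exact: perm_process_is_process.
  by split=> //; exact: perm_process_markov.
split; first exact: perm_process_is_process.
split; first exact: perm_process_marginals.
split=> //; split; [exact: ae_smooth|exact: perm_process_indep].
Qed.

End Existence.

Theorem theorem1 (R : realType) (n : nat) :
  (exists (d : measure_display) (T : measurableType d) (P : probability T R)
          (M : R -> T -> 'S_n),
      cadlag_markov_process P M /\ regular_mallows P M) /\
  (forall (d1 : measure_display) (T1 : measurableType d1) (P1 : probability T1 R)
          (M1 : R -> T1 -> 'S_n)
          (d2 : measure_display) (T2 : measurableType d2) (P2 : probability T2 R)
          (M2 : R -> T2 -> 'S_n),
      cadlag_markov_process P1 M1 -> regular_mallows P1 M1 ->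
      cadlag_markov_process P2 M2 -> regular_mallows P2 M2 ->
      same_law P1 M1 P2 M2).
Proof.
split; last by move=> *; exact: regular_mallows_same_law.
have [d [T [P [tau fam]]]] := @family_exists R n.
by exists d, T, P, (perm_process n tau); exact: perm_process_regular.
Qed.
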